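(* Let $d\ge1$ be an integer, let $\Gamma=(G,l)$ and $\Gamma_T=(T,l_T)$ be metric graphs with $T$ a tree, and let $\varphi:(G,l)\to(T,l_T)$ be a non-degenerate harmonic morphism of degree $d$. Then, for any point $t\in\Gamma_T$, the divisor $D:=\varphi^*(t)$ on $\Gamma$ has degree $d$ and rank at least $1$ (that is, $D\in W^1_d(\Gamma)$).
   Context: Graphs are finite and connected; multiple edges and loops are allowed. $E_v(G)$ denotes the set of edges incident to $v$. A metric graph $\Gamma=(G,l)$ is the metric space obtained from a graph $G$ and a length function $l:E(G)\to\mathbb R_{>0}$ by gluing intervals $[0,l(e)]$ according to $G$; $(G,l)$ is called a model of $\Gamma$. A morphism of graphs $\varphi:G\to G'$ is a map $V(G)\cup E(G)\to V(G')\cup E(G')$ with $\varphi(V(G))\subseteq V(G')$ such that for $e=xy\in E(G)$: if $\varphi(e)\in V(G')$ then $\varphi(e)=\varphi(x)=\varphi(y)$; if $\varphi(e)\in E(G')$ then $\varphi(e)=\varphi(x)\varphi(y)$. It is indexed if each $e\in E(G)$ carries an integer $\mu_\varphi(e)\ge 0$ with $\mu_\varphi(e)=0$ iff $\varphi(e)\in V(G')$. It is harmonic if for every $x\in V(G)$ the number $m_\varphi(x)=\sum_{e\in E_x(G),\,\varphi(e)=e'}\mu_\varphi(e)$ is the same for all $e'\in E_{\varphi(x)}(G')$ ($m_\varphi(x)=0$ if there is no such $e'$). It is non-degenerate if it contracts no loops and $m_\varphi(x)\ge 1$ for all $x\in V(G)$. Its degree is $\sum_{e\in E(G),\,\varphi(e)=e'}\mu_\varphi(e)$,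 independent of $e'\in E(G')$. A morphism of metric graphs $(G,l)\to(G',l')$ is induced by an indexed morphism $\varphi:G\to G'$ with $\mu_\varphi(e)=l'(\varphi(e))/l(e)\in\mathbb Z$ whenever $\varphi(e)\in E(G')$ (and $\mu_\varphi(e)=0$ otherwise); it is a continuous map, linear along edges. It is harmonic, non-degenerate, of degree $d$ if $\varphi$ is. The horizontal multiplicity $m_\varphi(x)$ at a point $x\in\Gamma$ is defined as follows: if $x\in V(G)$, it is the number $m_\varphi(x)=\sum_{e\in E_x(G),\,\varphi(e)=e'}\mu_\varphi(e)$ for any $e'\in E_{\varphi(x)}(G')$ (and $0$ if there is no such $e'$); if $x$ lies in the interior of the edge $e$, it is $\mu_\varphi(e)$. A divisor on $\Gamma$ is a finite formal sum $D=\sum_{x\in\Gamma}D(x)x$, $D(x)\in\mathbb Z$, with degree $\sum D(x)$; it is effective if all $D(x)\ge0$. The pullback of a divisor $D'$ on $\Gamma'$ is $(\varphi^*D')(x)=m_\varphi(x)\,D'(\varphi(x))$. A rational function is a continuous piecewise linear $f:\Gamma\to\mathbb R$ with integer slopes; $\operatorname{div}(f)(x)$ is the sum of the outgoing slopes of $f$ at $x$. $D\sim D'$ if $D-D'=\operatorname{div}(f)$ for some $f$. The rank is $\operatorname{rk}(D)=-1$ if $D$ is not equivalent to an effective divisor, and otherwise the largest $k\ge0$ such that for every effective $E$ of degree $k$, $D-E$ is equivalent to an effective divisor. $W^r_d(\Gamma)$ is the set of linear equivalence classes of degree $d$ divisors of rank at least $r$. *)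

(* Defs.v *)
From HB Require Import structures.
From mathcomp Require Import all_boot all_order all_algebra.
From mathcomp Require Import all_classical all_reals all_analysis.
From mathcomp.multinomials Require Export freeg.

Set Implicit Arguments.
Unset Strict Implicit.
Unset Printing Implicit Defensive.

Import Order.TTheory GRing.Theory Num.Theory.
Import numFieldNormedType.Exports.

Local Open Scope classical_set_scope.
Local Open Scope ring_scope.

(* The order of the two ends of an edge is an arbitrary reference orientation,
   used only to parametrize the edge. *)
Record multigraph := Multigraph {
  vert : finType;
  edge : finType;
  src : edge -> vert;
  tgt : edge -> vert }.

Section Multigraph.
Variable G : multigraph.

Definition adjacent (x y : vert G) : bool :=
  [exists e : edge G, ((src e == x) && (tgt e == y))
                   || ((src e == y) && (tgt e == x))].

Definition connected_graph : Prop :=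
  (0 < #|vert G|)%N /\ forall x y : vert G, connect adjacent x y.

(* A loop at v belongs once to the set E_v of edges incident to v. *)
Definition incident (e : edge G) (v : vert G) : bool :=
  (src e == v) || (tgt e == v).

(* An edge together with a direction; [true] is the reference direction. *)
Definition dart : Type := (edge G * bool)%type.
Definition dart_tail (a : dart) : vert G := if a.2 then src a.1 else tgt a.1.
Definition dart_head (a : dart) : vert G := if a.2 then tgt a.1 else src a.1.

(* Loops are cycles of length 1 and pairs of parallel edges are cycles of
   length 2; requiring distinct edges excludes going back and forth. *)
Definition graph_cycle (c : seq dart) : bool :=
  [&& c != [::],
      cycle (fun a b => dart_head a == dart_tail b) c,
      uniq [seq dart_tail a | a <- c] &
      uniq [seq a.1 | a <- c]].

Definition is_tree : Prop :=
  connected_graph /\ forall c : seq dart, ~~ graph_cycle c.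

End Multigraph.

Record metric_graph (R : realType) := MetricGraph {
  model :> multigraph;
  model_connected : connected_graph model;
  len : edge model -> R;
  len_gt0 : forall e, 0 < len e }.

(* A point of the space obtained by gluing the intervals [0, len e] is either
   a vertex or an interior point (e, s), 0 < s < len e, of an edge. *)
Definition is_point (R : realType) (Gam : metric_graph R)
    (p : vert Gam + edge Gam * R) : bool :=
  match p with inl _ => true | inr (e, s) => 0 < s < len e end.

Record graph_point (R : realType) (Gam : metric_graph R) := Point {
  point_val : vert Gam + edge Gam * R;
  point_valP : is_point point_val }.

HB.instance Definition _ (R : realType) (Gam : metric_graph R) :=
  [isSub for @point_val R Gam].
HB.instance Definition _ (R : realType) (Gam : metric_graph R) :=
  [Choice of graph_point Gam by <:].

Notation divisor Gam := {freeg (graph_point Gam) / int}.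

Section MetricGraph.
Variables (R : realType) (Gam : metric_graph R).

Definition vertex_point (v : vert Gam) : graph_point Gam :=
  @Point R Gam (inl v) (erefl true).

(* The gluing map [0, len e] -> Gam; outside of [0, len e] it is extended by
   constants. *)
Definition edge_point (e : edge Gam) (s : R) : graph_point Gam :=
  insubd (vertex_point (if s <= 0 then src e else tgt e)) (inr (e, s)).

(* Gam carries the quotient topology of the gluing, so f is continuous iff its
   pullback to each interval is. *)
Definition continuous_on_graph (f : graph_point Gam -> R) : Prop :=
  forall e : edge Gam,
    {within `[0, len e], continuous (fun s : R => f (edge_point e s))}.

Definition pl_integer_slopes (f : graph_point Gam -> R) : Prop :=
  forall e : edge Gam, exists2 ts : seq R,
    path <%R 0 ts /\ last 0 ts = len e &
    forall i, (i < size ts)%N -> exists (k : int) (c : R),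
      forall s : R, nth 0 (0 :: ts) i < s < nth 0 (0 :: ts) i.+1 ->
        f (edge_point e s) = k%:~R * s + c.

Definition rational_function (f : graph_point Gam -> R) : Prop :=
  continuous_on_graph f /\ pl_integer_slopes f.

Definition slope_fwd (f : graph_point Gam -> R) (e : edge Gam) (s : R) : R :=
  lim (((f (edge_point e (s + h)) - f (edge_point e s)) / h) @[h --> 0^'+]).

Definition slope_bwd (f : graph_point Gam -> R) (e : edge Gam) (s : R) : R :=
  lim (((f (edge_point e (s - h)) - f (edge_point e s)) / h) @[h --> 0^'+]).

(* The sum of the outgoing slopes of f at x; a loop at x contributes two
   outgoing directions. *)
Definition sum_out_slopes (f : graph_point Gam -> R) (x : graph_point Gam)
    : R :=
  match val x with
  | inl v => \sum_(e : edge Gam | src e == v) slope_fwd f e 0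
           + \sum_(e : edge Gam | tgt e == v) slope_bwd f e (len e)
  | inr (e, s) => slope_fwd f e s + slope_bwd f e s
  end.

Definition is_div (f : graph_point Gam -> R) (D : divisor Gam) : Prop :=
  forall x : graph_point Gam, (coeff x D)%:~R = sum_out_slopes f x.

Definition lin_equiv (D D' : divisor Gam) : Prop :=
  exists2 f : graph_point Gam -> R, rational_function f & is_div f (D - D').

Definition effective (D : divisor Gam) : Prop :=
  forall x : graph_point Gam, 0 <= coeff x D.

Definition equiv_effective (D : divisor Gam) : Prop :=
  exists2 D' : divisor Gam, effective D' & lin_equiv D D'.

Definition effective_minus_any (D : divisor Gam) (k : nat) : Prop :=
  forall E : divisor Gam, effective E -> deg E = k%:Z -> equiv_effective (D - E).

(* The largest k always exists when D is equivalent to an effective divisor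
   (it is at most deg D), so the default value of [xget] is never used. *)
Definition divisor_rank (D : divisor Gam) : int :=
  if `[< equiv_effective D >] then
    xget (-1) [set r : int | exists k : nat,
      [/\ r = k%:Z, effective_minus_any D k &
          forall j : nat, effective_minus_any D j -> (j <= k)%N]]
  else -1.

Definition lin_class (D : divisor Gam) : set (divisor Gam) :=
  [set D' | lin_equiv D D'].

Definition W (r d : int) : set (set (divisor Gam)) :=
  [set lin_class D | D in
    [set D : divisor Gam | deg D = d /\ r <= divisor_rank D]].

End MetricGraph.

(* [vmap] and [emap] are the restrictions of the morphism to vertices and
   edges; [emap e = inl v] means that e is contracted to v. *)
Record indexed_morphism (G G' : multigraph) := IndexedMorphism {
  vmap : vert G -> vert G';
  emap : edge G -> vert G' + edge G';
  emap_contracted : forall e v, emap e = inl v ->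
    vmap (src e) = v /\ vmap (tgt e) = v;
  emap_edge : forall e e', emap e = inr e' ->
       (src e' = vmap (src e) /\ tgt e' = vmap (tgt e))
    \/ (src e' = vmap (tgt e) /\ tgt e' = vmap (src e));
  mu : edge G -> nat;
  mu_eq0 : forall e, mu e = 0%N <-> exists v, emap e = inl v }.

Section IndexedMorphism.
Variables (G G' : multigraph) (phi : indexed_morphism G G').

Definition mult_over (x : vert G) (e' : edge G') : nat :=
  \sum_(e : edge G | incident e x && (emap phi e == inr e')) mu phi e.

Definition harmonic_morphism : Prop :=
  forall (x : vert G) (e1 e2 : edge G'),
    incident e1 (vmap phi x) -> incident e2 (vmap phi x) ->
    mult_over x e1 = mult_over x e2.

Definition vmult (x : vert G) : nat :=
  if [pick e' : edge G' | incident e' (vmap phi x)] is Some e'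
  then mult_over x e' else 0%N.

Definition nondegenerate_morphism : Prop :=
  (forall e : edge G, src e = tgt e -> forall v, emap phi e <> inl v) /\
  (forall x : vert G, (1 <= vmult x)%N).

(* If G' has no edge this holds for every d, but then [nondegenerate_morphism]
   fails, as every [vmult x] is 0. *)
Definition morphism_has_degree (d : nat) : Prop :=
  forall e' : edge G', (\sum_(e : edge G | emap phi e == inr e') mu phi e)%N = d.

End IndexedMorphism.

(* The continuous map is a field, constrained to be the one induced by the
   indexed morphism: when e' is a loop, the graph morphism does not determine
   in which direction an edge e with image e' is mapped onto e'. *)
Record metric_morphism (R : realType) (Gam Gam' : metric_graph R) :=
  MetricMorphism {
  mm_graph :> indexed_morphism Gam Gam';
  mm_mu : forall e e', emap mm_graph e = inr e' ->
    (mu mm_graph e)%:R = len e' / len e;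
  mm_map : graph_point Gam -> graph_point Gam';
  mm_vertex : forall v : vert Gam,
    mm_map (vertex_point v) = vertex_point (vmap mm_graph v);
  mm_contracted : forall e v, emap mm_graph e = inl v ->
    forall s, 0 <= s <= len e -> mm_map (edge_point e s) = vertex_point v;
  mm_edge : forall e e', emap mm_graph e = inr e' ->
       (forall s, 0 <= s <= len e ->
          mm_map (edge_point e s) = edge_point e' ((mu mm_graph e)%:R * s))
    \/ (forall s, 0 <= s <= len e ->
          mm_map (edge_point e s) =
            edge_point e' (len e' - (mu mm_graph e)%:R * s)) }.

Section MetricMorphism.
Variables (R : realType) (Gam Gam' : metric_graph R).
Variable phi : metric_morphism Gam Gam'.

Definition horizontal_mult (x : graph_point Gam) : nat :=
  match val x with
  | inl v => vmult phi v
  | inr (e, _) => mu phi e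
  end.

(* [\sum_(x \in A)] is a sum over a finite support (and 0 if the support is
   infinite); finiteness is proved in [coeff_pullback]. *)
Definition pullback (D' : divisor Gam') : divisor Gam :=
  \sum_(x \in [set: graph_point Gam])
    << (horizontal_mult x)%:Z * coeff (mm_map phi x) D' *g x >>.

Lemma mm_map_inner (e : edge Gam) (e' : edge Gam') (x : graph_point Gam) s :
  val x = inr (e, s) -> emap phi e = inr e' ->
  val (mm_map phi x) = inr (e', (mu phi e)%:R * s) \/
  val (mm_map phi x) = inr (e', len e' - (mu phi e)%:R * s).
Proof.
move=> vx ee'.
have := valP x; rewrite vx /= => /andP[s0 sl].
have xE : x = edge_point e s by apply/val_inj; rewrite vx val_insubd /= s0 sl.
have lE : len e' = (mu phi e)%:R * len e.
  by rewrite (mm_mu ee') mulfVK// gt_eqF// len_gt0.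
have m0 : 0 < (mu phi e)%:R :> R by rewrite (mm_mu ee') divr_gt0// len_gt0.
have ms0 : 0 < (mu phi e)%:R * s by rewrite mulr_gt0.
have msl : (mu phi e)%:R * s < len e' by rewrite lE ltr_pM2l.
have [/(_ s)|/(_ s)] := mm_edge ee'; rewrite !ltW// => /(_ isT) fE.
  by left; rewrite xE fE val_insubd /= ms0 msl.
by right; rewrite xE fE val_insubd /= subr_gt0 msl ltrBlDr ltrDl ms0.
Qed.

Lemma coeff_pullback (D' : divisor Gam') (x : graph_point Gam) :
  coeff x (pullback D') =
  (horizontal_mult x)%:Z * coeff (mm_map phi x) D'.
Proof.
pose c y := (horizontal_mult y)%:Z * coeff (mm_map phi y) D'.
have [r [rU rP]] : exists r : seq (graph_point Gam),
    uniq r /\ forall y, c y != 0 -> y \in r.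
  pose cand (y' : graph_point Gam') (e : edge Gam) : seq R :=
    match val y' with
    | inl _ => [::]
    | inr (e', s') => [:: s' / (mu phi e)%:R; (len e' - s') / (mu phi e)%:R]
    end.
  pose l : seq (vert Gam + edge Gam * R) :=
    [seq inl v | v <- enum (vert Gam)] ++
    flatten [seq flatten [seq [seq inr (e, s) | s <- cand y' e]
                         | e <- enum (edge Gam)] | y' <- dom D'].
  exists (undup (pmap insub l)); split=> [|y cy]; first exact: undup_uniq.
  rewrite mem_undup.
  suff : val y \in l by move=> yl; rewrite mem_pmap; apply/mapP; exists (val y);
    rewrite ?valK.
  have yD : mm_map phi y \in dom D'.
    by apply: contraR cy => /coeff_outdom cD; rewrite /c cD mulr0.
  rewrite mem_cat; case vy : (val y) => [v|[e s]].
    by apply/orP; left; rewrite map_f// mem_enum.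
  apply/orP; right; apply/flattenP.
  exists (flatten [seq [seq inr (e, s) | s <- cand (mm_map phi y) e]
                  | e <- enum (edge Gam)]); first exact: map_f.
  apply/flattenP; exists [seq inr (e, s) | s <- cand (mm_map phi y) e].
    by apply/mapP; exists e => //; rewrite mem_enum.
  apply/map_f.
  have mu_neq0 : (mu phi e != 0)%N.
    by apply: contraNneq cy => m0; rewrite /c /horizontal_mult vy m0 mul0r.
  have mR : (mu phi e)%:R != 0 :> R by rewrite pnatr_eq0.
  case ee' : (emap phi e) => [v|e'].
    by case/eqP: mu_neq0; apply/mu_eq0; exists v.
  rewrite /cand; have [->|->] := mm_map_inner vy ee'.
    by rewrite mulrAC mulfV// mul1r mem_head.
  by rewrite subKr mulrAC mulfV// mul1r in_cons mem_head orbT.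
rewrite /pullback (@fsbigE _ _ _ _ _ r) //=; last first.
  move=> y _ /(contraNeq (rP y)); rewrite /c => ->; exact: freegU0.
under eq_bigl do rewrite in_setT.
rewrite raddf_sum /= -/(c x).
under eq_bigr do rewrite coeffU.
have [xr|xr] := boolP (x \in r).
  rewrite (bigD1_seq x) //= eqxx mulr1 big1 ?addr0 // => y /negPf ->.
  by rewrite mulr0.
rewrite (contraNeq (rP x) xr) big_seq big1 // => y yr.
by rewrite (_ : y == x = false) ?mulr0 //; apply: contraNF xr => /eqP <-.
Qed.

End MetricMorphism.

(* Main.v *)
Require Import Defs.
From mathcomp Require Import all_boot all_order all_algebra.
From mathcomp Require Import reals classical_sets.
From mathcomp Require Import all_classical all_reals all_analysis.
From mathcomp Require Import lra ring.

(** Linear equivalence pulls back along the harmonic morphism: for a rational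
    function f on the tree, div (f o phi) = phi^* (div f). On a tree any two
    points t, t' are equivalent, because cutting an edge disconnects it and so a
    function with slope 1 along part of that edge and constant elsewhere is well
    defined. Hence phi^* t ~ phi^* (phi x) for every point x, and the latter
    divisor contains x when x has positive multiplicity. Otherwise x is inside a
    contracted edge, both ends of which lie in phi^* (phi x), and their two chips
    can be moved at equal speed until one of them sits at x. The degree is read
    off at the midpoint of an edge of the tree. That the rank, defined as a
    maximum, is attained uses deg (div f) = 0. *)

Set Implicit Arguments.
Unset Strict Implicit.
Unset Printing Implicit Defensive.

Import Order.TTheory GRing.Theory Num.Theory.
Import numFieldNormedType.Exports.
Local Open Scope classical_set_scope.
Local Open Scope ring_scope.

(** * Piecewise linear functions on an interval *)

Section PiecewiseLinear.
Variable R : realType.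
Implicit Types (F G : R -> R) (a b c k l s x L : R) (ts : seq R).

(** The closed interval builds one-sided continuity at both ends into linearity. *)
Definition linear_on F a b k : Prop :=
  forall s, a <= s <= b -> F s = F a + k * (s - a).

Lemma linear_on_sub F a b k c d : linear_on F a b k ->
  a <= c -> d <= b -> linear_on F c d k.
Proof.
move=> lF ac db s /andP[cs sd].
rewrite (lF s) ?(le_trans ac cs) ?(le_trans sd)//.
by rewrite (lF c) ?ac ?(le_trans cs (le_trans sd db))//; lra.
Qed.

Lemma linear_on_right F a b k : a < b -> linear_on F a b k ->
  F x @[x --> a^'+] --> F a.
Proof.
move=> ab lF.
have : (fun x => F a + k * (x - a)) @ a^'+ --> F a + k * (a - a).
  by apply: cvg_at_right_filter; apply: cvgD; [exact: cvg_cst|];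
     apply: cvgM; [exact: cvg_cst|]; apply: cvgB; [exact: cvg_id|exact: cvg_cst].
rewrite subrr mulr0 addr0; apply: cvg_trans; apply: near_eq_cvg.
near=> x; rewrite -lF//; apply/andP; split; apply: ltW.
  by near: x; exact: nbhs_right_gt.
by near: x; exact: nbhs_right_lt.
Unshelve. all: by end_near. Qed.

Lemma linear_on_left F a b k : a < b -> linear_on F a b k ->
  F x @[x --> b^'-] --> F b.
Proof.
move=> ab lF.
have : (fun x => F a + k * (x - a)) @ b^'- --> F a + k * (b - a).
  by apply: cvg_at_left_filter; apply: cvgD; [exact: cvg_cst|];
     apply: cvgM; [exact: cvg_cst|]; apply: cvgB; [exact: cvg_id|exact: cvg_cst].
rewrite -lF ?lexx ?ltW//; apply: cvg_trans; apply: near_eq_cvg.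
near=> x; rewrite -lF//; apply/andP; split; apply: ltW.
  by near: x; exact: nbhs_left_gt.
by near: x; exact: nbhs_left_lt.
Unshelve. all: by end_near. Qed.

Definition right_slope F s k : Prop := exists2 b, s < b & linear_on F s b k.

(** Slopes are outgoing: to the left the parameter decreases, hence the sign. *)
Definition left_slope F s k : Prop := exists2 a, a < s & linear_on F a s (- k).

Lemma right_slope_lim F s k : right_slope F s k ->
  lim ((F (s + h) - F s) / h @[h --> 0^'+]) = k.
Proof.
move=> [b sb lF]; apply: cvg_lim; first exact: norm_hausdorff.
apply: (@cvg_trans _ ((fun=> k) @ (0 : R)^'+)); last exact: cvg_cst.
apply: near_eq_cvg; near=> h.
have h0 : 0 < h by near: h; exact: nbhs_right_gt.
have hb : h < b - s by near: h; apply: nbhs_right_lt; rewrite subr_gt0.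
rewrite lF; last by apply/andP; split; lra.
by field; rewrite gt_eqF.
Unshelve. all: by end_near. Qed.

Lemma left_slope_lim F s k : left_slope F s k ->
  lim ((F (s - h) - F s) / h @[h --> 0^'+]) = k.
Proof.
move=> [a sa lF]; apply: cvg_lim; first exact: norm_hausdorff.
apply: (@cvg_trans _ ((fun=> k) @ (0 : R)^'+)); last exact: cvg_cst.
apply: near_eq_cvg; near=> h.
have h0 : 0 < h by near: h; exact: nbhs_right_gt.
have hb : h < s - a by near: h; apply: nbhs_right_lt; rewrite subr_gt0.
rewrite (lF (s - h)); last by apply/andP; split; lra.
rewrite (lF s); last by apply/andP; split; lra.
by field; rewrite gt_eqF.
Unshelve. all: by end_near. Qed.

(* [ts] may be unsorted, redundant, or stick out of [0, L]; this makes the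
   union of two such sequences valid for a sum of functions. *)
Definition breakpoints F L ts : Prop :=
  forall a b, 0 <= a -> a < b -> b <= L ->
  (forall x, x \in ts -> ~~ (a < x < b)) ->
  exists k : int, linear_on F a b k%:~R.

(** Start from [L] and pull the right end back to each entry of [ts] that lies strictly between [s]
    and the current end. *)
Lemma breakpoints_next ts s L : s < L ->
  exists b, [/\ s < b, b <= L & forall x, x \in ts -> ~~ (s < x < b)].
Proof.
move=> sL; elim: ts => [|t ts [b [sb bL H]]]; first by exists L; split.
have [/andP[st tb]|n] := boolP (s < t < b).
  exists t; split=> //; first exact: le_trans (ltW tb) bL.
  move=> x; rewrite inE => /orP[/eqP->|/H]; first by rewrite ltxx andbF.
  by apply: contra => /andP[-> /lt_trans->].
by exists b; split=> // x; rewrite inE => /orP[/eqP->|/H].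
Qed.

Lemma breakpoints_prev ts s : 0 < s ->
  exists a, [/\ a < s, 0 <= a & forall x, x \in ts -> ~~ (a < x < s)].
Proof.
move=> s0; elim: ts => [|t ts [a [sa a0 H]]]; first by exists 0; split.
have [/andP[st tb]|n] := boolP (a < t < s).
  exists t; split=> //; first exact: le_trans a0 (ltW st).
  move=> x; rewrite inE => /orP[/eqP->|/H]; first by rewrite ltxx.
  by apply: contra => /andP[/(lt_trans st)->].
by exists a; split=> // x; rewrite inE => /orP[/eqP->|/H].
Qed.

Lemma breakpoints_right_slope F L ts s : breakpoints F L ts -> 0 <= s < L ->
  exists k : int, right_slope F s k%:~R.
Proof.
move=> bF /andP[s0 sL]; have [b [sb bL n]] := breakpoints_next ts sL.
by have [k lF] := bF s b s0 sb bL n; exists k, b.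
Qed.

Lemma breakpoints_left_slope F L ts s : breakpoints F L ts -> 0 < s <= L ->
  exists k : int, left_slope F s k%:~R.
Proof.
move=> bF /andP[s0 sL]; have [a [as_ a0 n]] := breakpoints_prev ts s0.
have [k lF] := bF a s a0 as_ sL n; exists (- k), a => //.
by rewrite mulrNz opprK.
Qed.

Lemma breakpoints_continuous F L ts : 0 < L -> breakpoints F L ts ->
  {within `[0, L], continuous F}.
Proof.
move=> L0 bF; apply/continuous_within_itvP => //; split.
- move=> x; rewrite in_itv/= => /andP[x0 xL]; apply/left_right_continuousP.
  have [k [a ax lF]] : exists k : int, left_slope F x k%:~R.
    by apply: breakpoints_left_slope bF _; rewrite x0 ltW.
  have [k' [b xb lF']] : exists k : int, right_slope F x k%:~R.
    by apply: breakpoints_right_slope bF _; rewrite xL ltW.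
  by split; [exact: linear_on_left lF|exact: linear_on_right lF'].
- have [k' [b xb lF']] : exists k : int, right_slope F 0 k%:~R.
    by apply: breakpoints_right_slope bF _; rewrite lexx.
  exact: linear_on_right lF'.
- have [k [a ax lF]] : exists k : int, left_slope F L k%:~R.
    by apply: breakpoints_left_slope bF _; rewrite lexx L0.
  exact: linear_on_left lF.
Qed.

(** [pl_integer_slopes] gives a linear formula on open intervals only; continuity carries it to the
    two ends by uniqueness of one-sided limits. *)
Lemma linear_on_closure F L a b k c : 0 <= a -> a < b -> b <= L ->
  {within `[0, L], continuous F} ->
  (forall s, a < s < b -> F s = k * s + c) -> linear_on F a b k.
Proof.
move=> a0 ab bL cF lF.
have /(continuous_within_itvP _ ab)[_ Fa Fb] : {within `[a, b], continuous F}.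
  apply: continuous_subspaceW cF => x /=; rewrite !in_itv/= => /andP[ax xb].
  by rewrite (le_trans a0)//= (le_trans xb).
have Ea : F a = k * a + c.
  apply: (cvg_unique _ Fa); first exact: norm_hausdorff.
  apply: (@cvg_trans _ ((fun x => k * x + c) @ a^'+)).
    apply: near_eq_cvg; near=> x; rewrite lF//; apply/andP; split.
      by near: x; exact: nbhs_right_gt.
    by near: x; exact: nbhs_right_lt.
  apply: cvg_at_right_filter; apply: cvgD; last exact: cvg_cst.
  by apply: cvgM; [exact: cvg_cst|exact: cvg_id].
have Eb : F b = k * b + c.
  apply: (cvg_unique _ Fb); first exact: norm_hausdorff.
  apply: (@cvg_trans _ ((fun x => k * x + c) @ b^'-)).
    apply: near_eq_cvg; near=> x; rewrite lF//; apply/andP; split.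
      by near: x; exact: nbhs_left_gt.
    by near: x; exact: nbhs_left_lt.
  apply: cvg_at_left_filter; apply: cvgD; last exact: cvg_cst.
  by apply: cvgM; [exact: cvg_cst|exact: cvg_id].
move=> s /andP[]; rewrite le_eqVlt => /predU1P[<- _|as_].
  by rewrite subrr mulr0 addr0.
rewrite le_eqVlt => /predU1P[->|sb]; first by rewrite Ea Eb; lra.
by rewrite Ea lF ?as_//; lra.
Unshelve. all: by end_near. Qed.

Lemma breakpoints_of_partition F L ts : 0 < L ->
  {within `[0, L], continuous F} -> last 0 ts = L ->
  (forall i, (i < size ts)%N -> exists (k : int) c,
    forall s, nth 0 (0 :: ts) i < s < nth 0 (0 :: ts) i.+1 ->
      F s = k%:~R * s + c) ->
  breakpoints F L ts.
Proof.
move=> L0 cF lastL lF a b a0 ab bL n.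
have hasb : has (fun x => b <= x) ts.
  apply/hasP; exists L => //; rewrite -lastL.
  by case: (ts) lastL L0 => [/= <-|x s _ _]; rewrite ?ltxx//= mem_last.
(* The piece containing ]a, b[ ends at the first partition point at or beyond [b]. The point before
   it is the initial 0 or lies below [b], and in the latter case it is at most [a] because [ts]
   avoids ]a, b[. *)
pose i := find (fun x => b <= x) ts.
have is_ : (i < size ts)%N by rewrite -has_find.
have bi : b <= nth 0 ts i by exact: (@nth_find _ 0 (fun x => b <= x)).
have ai : nth 0 (0 :: ts) i <= a.
  case E : i => [//|j] /=.
  have ji : (j < i)%N by rewrite E.
  have := @before_find _ 0 (fun x => b <= x) ts j ji.
  move/negbT; rewrite -ltNge => tb.
  have /n : nth 0 ts j \in ts by rewrite mem_nth// (ltn_trans ji).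
  by rewrite tb andbT -leNgt.
have [k [c kc]] := lF i is_; exists k.
apply: (@linear_on_closure _ L _ _ _ c) => // s /andP[as_ sb].
by apply: kc; rewrite (le_lt_trans ai)//= (lt_le_trans sb).
Qed.

Lemma breakpoints_partition F L ts : 0 < L -> breakpoints F L ts ->
  exists2 us : seq R, path <%R 0 us /\ last 0 us = L &
  forall i, (i < size us)%N -> exists (k : int) c,
    forall s, nth 0 (0 :: us) i < s < nth 0 (0 :: us) i.+1 ->
      F s = k%:~R * s + c.
Proof.
move=> L0 bF.
(* Sorting and removing duplicates gives a strictly increasing list; [L] is appended because a
   partition has to end there. *)
pose vs := sort <=%R (undup [seq x <- ts | 0 < x < L]).
have memvs x : (x \in vs) = (0 < x < L) && (x \in ts).
  by rewrite mem_sort mem_undup mem_filter.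
have vsP : path <%R 0 (rcons vs L).
  rewrite rcons_path; apply/andP; split; last first.
    have := mem_last 0 vs; rewrite inE => /predU1P[->//|].
    by rewrite memvs => /andP[/andP[]].
  rewrite lt_path_sortedE; apply/andP; split.
    by apply/allP => x; rewrite memvs => /andP[/andP[]].
  by rewrite sort_lt_sorted undup_uniq.
exists (rcons vs L); first by rewrite last_rcons.
move=> i; rewrite size_rcons => iv.
set us := 0 :: rcons vs L.
have usS : sorted <%R us by exact: vsP.
have szus : size us = (size vs).+2 by rewrite /us/= size_rcons.
have mem0L x : x \in us -> 0 <= x <= L.
  rewrite inE mem_rcons inE => /or3P[/eqP->|/eqP->|].
  - by rewrite lexx ltW.
  - by rewrite lexx ltW.
  - by rewrite memvs => /andP[/andP[/ltW-> /ltW->]].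
have [k kP] : exists k : int, linear_on F us`_i us`_i.+1 k%:~R.
  apply: bF.
  - by have /mem0L/andP[] : us`_i \in us by rewrite mem_nth// szus ltnW.
  - by rewrite lt_sorted_ltn_nth// inE szus// ltnW.
  - by have /mem0L/andP[] : us`_i.+1 \in us by rewrite mem_nth// szus.
  - move=> x xts; apply/negP => /andP[ix xi].
    have xus : x \in us.
      rewrite inE mem_rcons inE memvs xts andbT; apply/or3P/Or33/andP; split.
        apply: le_lt_trans ix.
        by have /mem0L/andP[] : us`_i \in us by rewrite mem_nth// szus ltnW.
      apply: lt_le_trans xi _.
      by have /mem0L/andP[] : us`_i.+1 \in us by rewrite mem_nth// szus.
    (* Since [us] is strictly increasing, an entry between two consecutive ones would have an index
       strictly between [i] and [i.+1]. *)
    move: ix xi; rewrite -(nth_index 0 xus).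
    rewrite !lt_sorted_ltn_nth ?inE ?szus ?index_mem -?szus//; last first.
    - by rewrite index_mem.
    - by rewrite szus ltnW.
    - by rewrite szus.
    - by rewrite index_mem.
    by move=> ii; rewrite ltnS leqNgt ii.
exists k, (F us`_i - k%:~R * us`_i) => s /andP[s1 s2].
by rewrite kP ?ltW//; lra.
Qed.

Lemma breakpointsB F G L ts us : breakpoints F L ts -> breakpoints G L us ->
  breakpoints (fun s => F s - G s) L (ts ++ us).
Proof.
move=> bF bG a b a0 ab bL n.
have [k lF] : exists k : int, linear_on F a b k%:~R.
  by apply: bF => // x xt; apply: n; rewrite mem_cat xt.
have [l lG] : exists k : int, linear_on G a b k%:~R.
  by apply: bG => // x xt; apply: n; rewrite mem_cat xt orbT.
by exists (k - l) => s sab; rewrite lF// lG// mulrzBr; lra.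
Qed.

Lemma right_slopeB F G s k l : right_slope F s k -> right_slope G s l ->
  right_slope (fun s => F s - G s) s (k - l).
Proof.
move=> [b sb lF] [c sc lG]; exists (Num.min b c); first by rewrite lt_min sb.
move=> x /andP[sx]; rewrite le_min => /andP[xb xc].
by rewrite lF ?sx// lG ?sx//; lra.
Qed.

Lemma left_slopeB F G s k l : left_slope F s k -> left_slope G s l ->
  left_slope (fun s => F s - G s) s (k - l).
Proof.
move=> [b sb lF] [c sc lG]; exists (Num.max b c); first by rewrite gt_max sb.
have bm : b <= Num.max b c by rewrite le_max lexx.
have cm : c <= Num.max b c by rewrite le_max lexx orbT.
have sm : Num.max b c < s by rewrite gt_max sb.
move=> x /andP[]; move: bm cm sm; move: (Num.max b c) => m bm cm sm mx xs.
rewrite (lF x) ?xs ?(le_trans bm)// (lG x) ?xs ?(le_trans cm)//.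
rewrite (lF m) ?bm 1?ltW// (lG m) ?cm 1?ltW//; lra.
Qed.

(* On each maximal segment of linearity, the outgoing slopes at its two ends
   cancel. *)
Lemma sum_slopes_eq0 F L ts (r l : R -> R) a us :
  (forall s k, right_slope F s k -> r s = k) ->
  (forall s k, left_slope F s k -> l s = k) ->
  breakpoints F L ts -> 0 <= a -> a < L -> path <%R a us ->
  (forall x, x \in us -> x < L) ->
  (forall x, x \in ts -> a < x < L -> x \in us) ->
  r a + l L + \sum_(x <- us) (r x + l x) = 0.
Proof.
move=> rP lP bF; elim: us a => [|y us IH] a a0 aL /=.
  move=> _ _ tsus; rewrite big_nil.
  have [k lF] : exists k : int, linear_on F a L k%:~R.
    by apply: bF => // x xts; apply/negP => /(tsus _ xts).
  rewrite (rP a k%:~R) ?(lP L (- k%:~R)) ?subrr ?addr0//; last by exists L.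
  by exists a => //; rewrite opprK.
move=> /andP[ay yus] usL tsus.
have yL : y < L by apply: usL; rewrite mem_head.
have [k lF] : exists k : int, linear_on F a y k%:~R.
  apply: bF => //; first exact: ltW.
  move=> x xts; apply/negP => /andP[ax xy].
  have := tsus _ xts; rewrite ax (lt_trans xy yL) => /(_ isT).
  rewrite inE => /predU1P[xy'|xus]; first by rewrite xy' ltxx in xy.
  have /allP/(_ _ xus) := order_path_min lt_trans yus.
  by move=> /(lt_trans xy); rewrite ltxx.
have ra : r a = k%:~R by apply: rP; exists y.
have ly : l y = - k%:~R by apply: lP; exists a => //; rewrite opprK.
have := IH y (ltW (le_lt_trans a0 ay)) yL yus.
rewrite big_cons ra ly => /(_ _)/(_ _) E.
suff : r y + l L + \sum_(x <- us) (r x + l x) = 0 by lra.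
apply: E; first by move=> x xus; apply: usL; rewrite inE xus orbT.
move=> x xts /andP[yx xL]; have := tsus x xts.
rewrite (lt_trans ay yx) xL inE => /(_ isT)/predU1P[xy|//].
by rewrite xy ltxx in yx.
Qed.

Lemma linear_on_eq F G a b k : (forall s, a <= s <= b -> F s = G s) ->
  a <= b -> linear_on G a b k -> linear_on F a b k.
Proof. by move=> FG ab lG s sab; rewrite !FG ?lexx//; exact: lG. Qed.

Lemma breakpoints_eq F G L ts : (forall s, 0 <= s <= L -> F s = G s) ->
  breakpoints G L ts -> breakpoints F L ts.
Proof.
move=> FG bG a b a0 ab bL /(bG a b a0 ab bL)[k lG]; exists k.
apply: linear_on_eq lG; last exact: ltW.
by move=> s /andP[as_ sb]; rewrite FG// (le_trans a0)//= (le_trans sb).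
Qed.

(** As [s < L], the segment of linearity to the right of [s] can be cut off at [L], so that
    agreement on [0, L] is enough. Beyond it [edge_point] is only a constant extension. *)
Lemma right_slope_eq F G L s k : (forall s, 0 <= s <= L -> F s = G s) ->
  0 <= s < L -> right_slope G s k -> right_slope F s k.
Proof.
move=> FG /andP[s0 sL] [b sb lG]; exists (Num.min b L); first by rewrite lt_min sb.
apply: (@linear_on_eq _ G); last first.
- by apply: linear_on_sub lG _ _; rewrite ?ge_min ?lexx.
- by rewrite le_min !ltW.
- by move=> x /andP[sx]; rewrite le_min => /andP[_ xL]; rewrite FG// (le_trans s0).
Qed.

Lemma left_slope_eq F G L s k : (forall s, 0 <= s <= L -> F s = G s) ->
  0 < s <= L -> left_slope G s k -> left_slope F s k.
Proof.
move=> FG /andP[s0 sL] [a as_ lG]; exists (Num.max a 0); first by rewrite gt_max as_.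
apply: (@linear_on_eq _ G); last first.
- by apply: linear_on_sub lG _ _; rewrite ?le_max ?lexx.
- by rewrite ge_max !ltW.
- by move=> x /andP[]; rewrite ge_max => /andP[_ x0] xs; rewrite FG// x0 (le_trans xs).
Qed.

Lemma linear_on_scale F (m a b k : R) : 0 < m ->
  linear_on F (m * a) (m * b) k -> linear_on (fun s => F (m * s)) a b (m * k).
Proof.
move=> m0 lF s /andP[as_ sb]; rewrite lF ?ler_pM2l ?as_//.
by rewrite -mulrBr mulrA [k * m]mulrC.
Qed.

Lemma linear_on_rev F (l a b k : R) :
  linear_on F (l - b) (l - a) k -> linear_on (fun s => F (l - s)) a b (- k).
Proof.
move=> lF s /andP[as_ sb]; rewrite (lF (l - s)) ?lerD2l ?lerN2 ?sb//.
rewrite (lF (l - a)) ?lexx ?lerD2l ?lerN2 ?(le_trans as_)//; lra.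
Qed.

Lemma breakpoints_scale F L ts (m : nat) : (0 < m)%N ->
  breakpoints F (m%:R * L) ts ->
  breakpoints (fun s => F (m%:R * s)) L [seq t / m%:R | t <- ts].
Proof.
move=> m0 bF a b a0 ab bL n; have m0R : 0 < m%:R :> R by rewrite ltr0n.
have [||||k lF] := bF (m%:R * a) (m%:R * b).
- by rewrite mulr_ge0// ltW.
- by rewrite ltr_pM2l.
- by rewrite ler_pM2l.
- move=> x xts; have := n (x / m%:R) (map_f _ xts).
  by rewrite ltr_pdivlMr// ltr_pdivrMr// ![_ * m%:R]mulrC.
by exists (m%:Z * k); rewrite intrM; exact: linear_on_scale.
Qed.

Lemma breakpoints_rev F L ts : breakpoints F L ts ->
  breakpoints (fun s => F (L - s)) L [seq L - t | t <- ts].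
Proof.
move=> bF a b a0 ab bL n.
have [||||k lF] := bF (L - b) (L - a); [lra|lra|lra| |].
  move=> x xts; have := n (L - x) (map_f _ xts).
  by apply: contra => /andP[ax xb]; apply/andP; split; lra.
by exists (- k); rewrite mulrNz; exact: linear_on_rev.
Qed.

Lemma right_slope_scale F s k (m : R) : 0 < m -> right_slope F (m * s) k ->
  right_slope (fun s => F (m * s)) s (m * k).
Proof.
move=> m0 [b sb lF]; exists (b / m); first by rewrite ltr_pdivlMr// mulrC.
by apply: linear_on_scale => //; rewrite [m * (b / m)]mulrC divfK// gt_eqF.
Qed.

Lemma left_slope_scale F s k (m : R) : 0 < m -> left_slope F (m * s) k ->
  left_slope (fun s => F (m * s)) s (m * k).
Proof.
move=> m0 [b sb lF]; exists (b / m); first by rewrite ltr_pdivrMr// mulrC.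
rewrite -mulrN.
by apply: linear_on_scale => //; rewrite [m * (b / m)]mulrC divfK// gt_eqF.
Qed.

(** Reversal exchanges the two directions at a point; outgoing slopes therefore keep their sign. *)
Lemma right_slope_rev F (l s k : R) : left_slope F (l - s) k ->
  right_slope (fun s => F (l - s)) s k.
Proof.
move=> [a al lF]; exists (l - a); first by lra.
by rewrite -[k]opprK; apply: linear_on_rev; rewrite subKr.
Qed.

Lemma left_slope_rev F (l s k : R) : right_slope F (l - s) k ->
  left_slope (fun s => F (l - s)) s k.
Proof.
move=> [b lb lF]; exists (l - b); first by lra.
by apply: linear_on_rev; rewrite subKr.
Qed.

End PiecewiseLinear.

(** * Principal divisors *)

Section Divisors.
Variables (R : realType) (Gam : metric_graph R).
Implicit Types (e : edge Gam) (v : vert Gam) (s : R) (x : graph_point Gam).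
Implicit Types (f g : graph_point Gam -> R) (D : divisor Gam).

Lemma edge_point0 e : edge_point e 0 = vertex_point (src e).
Proof. by apply/val_inj; rewrite val_insubd /= ltxx lexx. Qed.

Lemma edge_point_len e : edge_point e (len e) = vertex_point (tgt e).
Proof.
by apply/val_inj; rewrite val_insubd /= ltxx andbF leNgt len_gt0.
Qed.

Lemma val_edge_point e s : 0 < s < len e -> val (edge_point e s) = inr (e, s).
Proof. by move=> s0; rewrite val_insubd /= s0. Qed.

Lemma val_inr_inner x e s : val x = inr (e, s) -> 0 < s < len e.
Proof. by move=> xE; have := valP x; rewrite xE. Qed.

Lemma val_inr_edge_point x e s : val x = inr (e, s) -> x = edge_point e s.
Proof.
by move=> xE; apply/val_inj; rewrite val_edge_point// (val_inr_inner xE).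
Qed.

Lemma val_inl_vertex_point x v : val x = inl v -> x = vertex_point v.
Proof. by move=> xE; apply/val_inj. Qed.

Lemma vertex_point_inj : injective (@vertex_point R Gam).
Proof. by move=> u v /(congr1 val)[]. Qed.

Lemma slope_fwdE f e s k :
  right_slope (fun s => f (edge_point e s)) s k -> slope_fwd f e s = k.
Proof. exact: right_slope_lim. Qed.

Lemma slope_bwdE f e s k :
  left_slope (fun s => f (edge_point e s)) s k -> slope_bwd f e s = k.
Proof. exact: left_slope_lim. Qed.

(** Replaces continuity and sorted partitions by lists of break points, which are easy to merge,
    rescale and reverse. *)
Lemma rational_functionP f : rational_function f <->
  exists ts : edge Gam -> seq R, forall e,
    breakpoints (fun s => f (edge_point e s)) (len e) (ts e).
Proof.
split=> [[cf plf]|[ts bf]].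
  suff /choice[ts tsP] : forall e, exists ts,
    breakpoints (fun s => f (edge_point e s)) (len e) ts by exists ts.
  move=> e; have [ts [_ lastE] tsP] := plf e; exists ts.
  exact: breakpoints_of_partition (len_gt0 e) (cf e) lastE tsP.
split=> e; first exact: breakpoints_continuous (len_gt0 e) (bf e).
exact: breakpoints_partition (len_gt0 e) (bf e).
Qed.

Lemma rational_right_slope f e s : rational_function f -> 0 <= s < len e ->
  exists k : int, right_slope (fun s => f (edge_point e s)) s k%:~R.
Proof.
by move=> /rational_functionP[ts bf]; exact: breakpoints_right_slope (bf e).
Qed.

Lemma rational_left_slope f e s : rational_function f -> 0 < s <= len e ->
  exists k : int, left_slope (fun s => f (edge_point e s)) s k%:~R.
Proof.
by move=> /rational_functionP[ts bf]; exact: breakpoints_left_slope (bf e).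
Qed.

Lemma rational_functionB f g : rational_function f -> rational_function g ->
  rational_function (fun x => f x - g x).
Proof.
move=> /rational_functionP[ts bf] /rational_functionP[us bg].
apply/rational_functionP; exists (fun e => ts e ++ us e) => e.
exact: breakpointsB.
Qed.

(** [slope_fwd] is a limit, so additivity rests on the existence of both slopes, which rationality
    provides. *)
Lemma slope_fwdB f g e s : rational_function f -> rational_function g ->
  0 <= s < len e ->
  slope_fwd (fun x => f x - g x) e s = slope_fwd f e s - slope_fwd g e s.
Proof.
move=> rf rg se; have [k kP] := rational_right_slope rf se.
have [l lP] := rational_right_slope rg se.
rewrite (slope_fwdE kP) (slope_fwdE lP).
by apply: slope_fwdE; exact: right_slopeB kP lP.
Qed.

Lemma slope_bwdB f g e s : rational_function f -> rational_function g ->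
  0 < s <= len e ->
  slope_bwd (fun x => f x - g x) e s = slope_bwd f e s - slope_bwd g e s.
Proof.
move=> rf rg se; have [k kP] := rational_left_slope rf se.
have [l lP] := rational_left_slope rg se.
rewrite (slope_bwdE kP) (slope_bwdE lP).
by apply: slope_bwdE; exact: left_slopeB kP lP.
Qed.

Lemma sum_out_slopesB f g x : rational_function f -> rational_function g ->
  sum_out_slopes (fun x => f x - g x) x = sum_out_slopes f x - sum_out_slopes g x.
Proof.
move=> rf rg; rewrite /sum_out_slopes; case xE: (val x) => [v|[e s]].
  rewrite opprD addrACA -!sumrB; congr (_ + _); apply: eq_bigr => e _.
    by apply: slope_fwdB => //; rewrite lexx len_gt0.
  by apply: slope_bwdB => //; rewrite lexx len_gt0.
have /andP[s0 sl] := val_inr_inner xE.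
rewrite slope_fwdB ?(ltW s0)// slope_bwdB ?s0 ?(ltW sl)//.
by rewrite opprD addrACA.
Qed.

Lemma linear_on_cst (c a b : R) : linear_on (fun=> c) a b 0.
Proof. by move=> s _; rewrite mul0r addr0. Qed.

Lemma rational_cst (c : R) : rational_function (fun _ : graph_point Gam => c).
Proof.
apply/rational_functionP; exists (fun=> [::]) => e a b _ _ _ _.
by exists 0; exact: linear_on_cst.
Qed.

Lemma sum_out_slopes_cst (c : R) x :
  sum_out_slopes (fun _ : graph_point Gam => c) x = 0.
Proof.
have fE e s : slope_fwd (fun _ : graph_point Gam => c) e s = 0.
  apply: slope_fwdE; exists (s + 1); first by rewrite ltrDl.
  exact: linear_on_cst.
have bE e s : slope_bwd (fun _ : graph_point Gam => c) e s = 0.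
  apply: slope_bwdE; exists (s - 1); first by rewrite gtrBl.
  by rewrite oppr0; exact: linear_on_cst.
rewrite /sum_out_slopes; case: (val x) => [v|[e s]]; last by rewrite fE bE addr0.
by rewrite !big1 ?addr0.
Qed.

Lemma lin_equiv_refl D : lin_equiv D D.
Proof.
exists (fun=> 0); first exact: rational_cst.
by move=> x; rewrite sum_out_slopes_cst subrr coeff0.
Qed.

(** Stated for differences so that, together with reflexivity, it also yields symmetry and
    transitivity. *)
Lemma lin_equiv_sub D1 D2 D3 D4 : lin_equiv D1 D2 -> lin_equiv D3 D4 ->
  lin_equiv (D1 - D3) (D2 - D4).
Proof.
move=> [f rf fD] [g rg gD]; exists (fun x => f x - g x).
  exact: rational_functionB.
move=> x; rewrite sum_out_slopesB// -fD -gD -rmorphB -coeffB; congr (coeff x _)%:~R.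
by rewrite !opprB addrACA [RHS]addrACA [X in _ + X = _]addrC.
Qed.

Lemma lin_equiv_sym D1 D2 : lin_equiv D1 D2 -> lin_equiv D2 D1.
Proof.
(* Subtract [D1] and [D2] respectively from the common divisor [D1 + D2]. *)
move=> h; have := lin_equiv_sub (lin_equiv_refl (D1 + D2)) h.
by rewrite addrAC subrr add0r addrK.
Qed.

Lemma lin_equiv_trans D1 D2 D3 :
  lin_equiv D1 D2 -> lin_equiv D2 D3 -> lin_equiv D1 D3.
Proof.
move=> h12 /lin_equiv_sym h32.
(* This gives [D1 - D3] equivalent to [D2 - D2]; then [D3] is added back on both sides. *)
have := lin_equiv_sub h12 h32.
move=> h; have := lin_equiv_sub h (lin_equiv_refl (- D3)).
by rewrite opprK subrK subrr add0r.
Qed.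

(** Rewrites the degree, a sum over the support, as a sum indexed by vertices and edges, which can
    be compared with sums of slopes or of multiplicities. The lists [us] may also contain points
    outside the support. *)
Lemma deg_vertex_edge (us : edge Gam -> seq R) D :
  (forall e, uniq (us e)) -> (forall e s, s \in us e -> 0 < s < len e) ->
  (forall x e s, x \in dom D -> val x = inr (e, s) -> s \in us e) ->
  deg D = \sum_v coeff (vertex_point v) D
          + \sum_e \sum_(s <- us e) coeff (edge_point e s) D.
Proof.
move=> usU us_in usP.
(* With every coefficient expanded over the support, exchanging sums reduces the claim to this: each
   support point is met exactly once on the right-hand side. *)
have coeffE y : coeff y D = \sum_(x <- dom D) coeff x D * (x == y)%:R.
  rewrite -{1}(freeg_sumE D) raddf_sum/=.
  by apply: eq_bigr => x _; rewrite coeffU.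
rewrite -{1}(freeg_sumE D) raddf_sum/=.
under eq_bigr do rewrite degU.
under [X in _ = X + _]eq_bigr do rewrite coeffE.
under [X in _ = _ + X]eq_bigr do (under eq_bigr do rewrite coeffE).
rewrite exchange_big /=.
under [X in _ = _ + X]eq_bigr do rewrite exchange_big /=.
rewrite [X in _ = _ + X]exchange_big /= -big_split /=.
rewrite [LHS]big_seq [RHS]big_seq; apply: eq_bigr => x xD.
case xE : (val x) => [v|[e s]].
  rewrite (val_inl_vertex_point xE) (bigD1 v)//= eqxx mulr1 big1 ?addr0.
    rewrite big1 ?addr0// => e _; rewrite big_seq big1// => s /us_in sl.
    rewrite -val_eqE (val_edge_point sl) /= -[X in _ * X]/(0 : int).
    by rewrite mulr0.
  by move=> w wv; rewrite (inj_eq vertex_point_inj) eq_sym (negPf wv) mulr0.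
have sus := usP _ _ _ xD xE.
rewrite [X in X + _]big1 ?add0r => [|v _]; last first.
  by rewrite -val_eqE xE mulr0.
rewrite (bigD1 e)//= [X in _ + X]big1 ?addr0 => [|e' e'e]; last first.
  rewrite big_seq big1// => s' /us_in sl.
  rewrite -val_eqE xE (val_edge_point sl).
  case: eqP => [[ee' _]|]; last by rewrite mulr0.
  by rewrite ee' eqxx in e'e.
rewrite (bigD1_seq s) ?usU//= (val_inr_edge_point xE) eqxx mulr1.
rewrite big_seq_cond big1 ?addr0// => s' /andP[/us_in sl ss].
rewrite -val_eqE (val_edge_point sl) (val_edge_point (us_in e s sus)).
case: eqP => [[ss' ]|]; last by rewrite mulr0.
by rewrite ss' eqxx in ss.
Qed.

(** All slopes at vertices are charged to their edges; edge by edge the total is then 0 by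
    [sum_slopes_eq0]. *)
Lemma deg_div f D : rational_function f -> is_div f D -> deg D = 0.
Proof.
move=> /rational_functionP[ts bf] fD.
pose on_edge e x : option R :=
  if val x is inr (e', s) then if e' == e then Some s else None else None.
(* Break points of [f] are needed for the cancellation of slopes, support points of [D] for the
   degree formula. *)
pose us e : seq R := sort <=%R (undup [seq s <- ts e ++ pmap (on_edge e) (dom D)
                                   | 0 < s < len e]).
have memus e s : (s \in us e) =
    (0 < s < len e) && ((s \in ts e) || (s \in pmap (on_edge e) (dom D))).
  by rewrite mem_sort mem_undup mem_filter mem_cat.
apply: (@intr_inj R); rewrite (@deg_vertex_edge us) => [|e|e s|x e s xD xE].
- rewrite rmorphD !rmorph_sum/=.
  under eq_bigr do rewrite fD /sum_out_slopes /=.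
  (* After the exchange each edge occurs once through its source and once through its target, loops
     included. *)
  rewrite big_split /= [X in X + _ + _](exchange_big_dep predT) //=.
  rewrite [X in _ + X + _](exchange_big_dep predT) //= -!big_split /=.
  rewrite big1// => e _.
  under [X in X + _ + _]eq_bigl do rewrite eq_sym.
  under [X in _ + X + _]eq_bigl do rewrite eq_sym.
  rewrite !big_pred1_eq rmorph_sum /=.
  under eq_big_seq => s.
    rewrite memus => /andP[sl _].
    rewrite fD /sum_out_slopes (val_edge_point sl); over.
  apply: (@sum_slopes_eq0 R (fun s => f (edge_point e s)) _ (ts e)) => //.
  + exact: slope_fwdE.
  + exact: slope_bwdE.
  + exact: len_gt0.
  + rewrite lt_path_sortedE sort_lt_sorted undup_uniq andbT.
    by apply/allP => s; rewrite memus => /andP[/andP[]].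
  + by move=> s; rewrite memus => /andP[/andP[]].
  + by move=> s sts sl; rewrite memus sl sts.
- by rewrite sort_uniq undup_uniq.
- by rewrite memus => /andP[].
- rewrite memus (val_inr_inner xE) mem_pmap; apply/orP; right.
  by apply/mapP; exists x => //; rewrite /on_edge xE eqxx.
Qed.

Lemma lin_equiv_deg D1 D2 : lin_equiv D1 D2 -> deg D1 = deg D2.
Proof.
by move=> [f rf /(deg_div rf)]; rewrite degB => /eqP; rewrite subr_eq0 => /eqP.
Qed.

Lemma effective_deg D : effective D -> 0 <= deg D.
Proof.
move=> eD; rewrite -(freeg_sumE D) raddf_sum/= sumr_ge0// => x _.
by rewrite degU.
Qed.

(** Test on [k] times one point: an effective divisor equivalent to the difference has degree
    [deg D - k], which must be nonnegative. *)
Lemma effective_minus_any_deg D k : inhabited (graph_point Gam) ->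
  effective_minus_any D k -> k%:Z <= deg D.
Proof.
move=> [x] /(_ << k%:Z *g x >>)[]; last 1 first.
- move=> D' /effective_deg eD' /lin_equiv_deg.
  by rewrite degB degU => E; rewrite -subr_ge0 E.
- by move=> y; rewrite coeffU mulr_ge0// ler0n.
- exact: degU.
Qed.

(** A value of [xget] is informative only if the set is nonempty; the degree bounds the candidates,
    so a largest one exists. *)
Lemma le_divisor_rank D k : inhabited (graph_point Gam) ->
  equiv_effective D -> effective_minus_any D k -> k%:Z <= divisor_rank D.
Proof.
move=> inh eD Dk; rewrite /divisor_rank asboolT//.
pose P j := `[< effective_minus_any D j >].
have exP : exists j, P j by exists k; apply/asboolP.
have bP j : P j -> (j <= `|deg D|)%N.
  move=> /asboolP/(effective_minus_any_deg inh) jD.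
  by rewrite -lez_nat abszE (le_trans jD)// ler_norm.
case: (ex_maxnP exP bP) => m /asboolP Dm mmax.
(* The second case, where [xget] would return its default, is refuted by the maximum [m]. *)
case: xgetP => [_ -> [j [-> _]]|/(_ m%:Z)[]].
  by move=> /(_ k Dk); rewrite lez_nat.
by exists m; split=> // j Dj; apply: mmax; apply/asboolP.
Qed.

End Divisors.

(** * Pullback of rational functions *)

Section Pullback.
Variables (R : realType) (Gam Gam' : metric_graph R).
Variable phi : metric_morphism Gam Gam'.
Hypothesis noloop : forall e' : edge Gam', src e' <> tgt e'.
Implicit Types (s : R).

Lemma mu_gt0 e e' : emap phi e = inr e' -> (0 < mu phi e)%N.
Proof.
by move=> ee'; rewrite lt0n; apply/eqP => /mu_eq0[v]; rewrite ee'.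
Qed.

Lemma len_image e e' : emap phi e = inr e' -> len e' = (mu phi e)%:R * len e.
Proof. by move=> ee'; rewrite (mm_mu ee') divfK// gt_eqF// len_gt0. Qed.

Lemma image_inner e e' s : emap phi e = inr e' -> 0 < s < len e ->
  0 < (mu phi e)%:R * s < len e'.
Proof.
move=> ee' /andP[s0 sl]; have m0 : 0 < (mu phi e)%:R :> R by rewrite ltr0n (mu_gt0 ee').
by rewrite (len_image ee') mulr_gt0// ltr_pM2l.
Qed.

(** A loop that is not contracted would be mapped onto a loop. *)
Lemma image_ends_neq e e' : emap phi e = inr e' -> src e <> tgt e.
Proof.
by move=> /emap_edge + st; rewrite st => -[[st1 st2]|[st1 st2]];
   apply: (@noloop e'); rewrite st1 st2.
Qed.

Lemma image_incident e e' v : emap phi e = inr e' -> incident e v ->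
  incident e' (vmap phi v).
Proof.
rewrite /incident => /emap_edge[[-> ->]|[-> ->]] /orP[]/eqP->;
by rewrite eqxx ?orbT.
Qed.

Section Function.
Variable f : graph_point Gam' -> R.
Hypothesis rf : rational_function f.
Local Notation g := (fun x => f (mm_map phi x)).

(** Along each edge [phi] is constant, or a scaling by [mu] possibly followed by a reversal; break
    points are transported through each of these. *)
Lemma rational_comp : rational_function g.
Proof.
have /rational_functionP[ts bf] := rf; apply/rational_functionP.
suff /choice[us usP] : forall e, exists us,
  breakpoints (fun s => g (edge_point e s)) (len e) us by exists us.
move=> e; case ee' : (emap phi e) => [v|e'].
  exists [::].
  apply: (@breakpoints_eq _ _ (fun=> f (vertex_point v))).
    by move=> s sl; rewrite (mm_contracted ee').
  by move=> a b _ _ _ _; exists 0; exact: linear_on_cst.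
have [H|H] := mm_edge ee'.
  exists [seq t / (mu phi e)%:R | t <- ts e'].
  apply: (@breakpoints_eq _ _ (fun s => f (edge_point e' ((mu phi e)%:R * s)))).
    by move=> s sl; rewrite H.
  apply: (@breakpoints_scale _ (fun s => f (edge_point e' s))).
    exact: mu_gt0 ee'.
  by rewrite -(len_image ee').
exists [seq t / (mu phi e)%:R | t <- [seq len e' - t | t <- ts e']].
apply: (@breakpoints_eq _ _
         (fun s => f (edge_point e' (len e' - (mu phi e)%:R * s)))).
  by move=> s sl; rewrite H.
apply: (@breakpoints_scale _ (fun s => f (edge_point e' (len e' - s)))).
  exact: mu_gt0 ee'.
rewrite -(len_image ee').
exact: (@breakpoints_rev _ (fun s => f (edge_point e' s))).
Qed.

Lemma slope_fwd_contracted e v s : emap phi e = inl v -> 0 <= s < len e ->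
  slope_fwd g e s = 0.
Proof.
move=> ev sl; apply: slope_fwdE.
apply: (right_slope_eq (G := fun=> f (vertex_point v)) _ sl).
  by move=> x xl; rewrite (mm_contracted ev).
by exists (s + 1); [rewrite ltrDl|exact: linear_on_cst].
Qed.

Lemma slope_bwd_contracted e v s : emap phi e = inl v -> 0 < s <= len e ->
  slope_bwd g e s = 0.
Proof.
move=> ev sl; apply: slope_bwdE.
apply: (left_slope_eq (G := fun=> f (vertex_point v)) _ sl).
  by move=> x xl; rewrite (mm_contracted ev).
by exists (s - 1); [rewrite gtrBl|rewrite oppr0; exact: linear_on_cst].
Qed.

(** The chain rule for a stretching by [mu]; a reversal, treated next, also exchanges the two
    directions. *)
Lemma slopes_preserving e e' : emap phi e = inr e' ->
  (forall s, 0 <= s <= len e ->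
     mm_map phi (edge_point e s) = edge_point e' ((mu phi e)%:R * s)) ->
  (forall s, 0 <= s < len e ->
     slope_fwd g e s = (mu phi e)%:R * slope_fwd f e' ((mu phi e)%:R * s)) /\
  (forall s, 0 < s <= len e ->
     slope_bwd g e s = (mu phi e)%:R * slope_bwd f e' ((mu phi e)%:R * s)).
Proof.
move=> ee' H; have m0 : 0 < (mu phi e)%:R :> R by rewrite ltr0n (mu_gt0 ee').
pose G s := f (edge_point e' ((mu phi e)%:R * s)).
have gG s : 0 <= s <= len e -> f (mm_map phi (edge_point e s)) = G s.
  by move=> sl; rewrite H.
split=> s sl.
- have /(rational_right_slope rf)[k kP] : 0 <= (mu phi e)%:R * s < len e'.
    move: sl => /andP[s0 sl].
    by rewrite (len_image ee') ltr_pM2l// sl mulr_ge0// ltW.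
  rewrite (slope_fwdE kP); apply/slope_fwdE/(right_slope_eq gG sl).
  exact: (right_slope_scale (F := fun s => f (edge_point e' s))).
- have /(rational_left_slope rf)[k kP] : 0 < (mu phi e)%:R * s <= len e'.
    move: sl => /andP[s0 sl].
    by rewrite (len_image ee') ler_pM2l// sl mulr_gt0.
  rewrite (slope_bwdE kP); apply/slope_bwdE/(left_slope_eq gG sl).
  exact: (left_slope_scale (F := fun s => f (edge_point e' s))).
Qed.

Lemma slopes_reversing e e' : emap phi e = inr e' ->
  (forall s, 0 <= s <= len e ->
     mm_map phi (edge_point e s) = edge_point e' (len e' - (mu phi e)%:R * s)) ->
  (forall s, 0 <= s < len e -> slope_fwd g e s =
     (mu phi e)%:R * slope_bwd f e' (len e' - (mu phi e)%:R * s)) /\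
  (forall s, 0 < s <= len e -> slope_bwd g e s =
     (mu phi e)%:R * slope_fwd f e' (len e' - (mu phi e)%:R * s)).
Proof.
move=> ee' H; have m0 : 0 < (mu phi e)%:R :> R by rewrite ltr0n (mu_gt0 ee').
pose G s := f (edge_point e' (len e' - (mu phi e)%:R * s)).
have gG s : 0 <= s <= len e -> f (mm_map phi (edge_point e s)) = G s.
  by move=> sl; rewrite H.
split=> s sl.
- have /(rational_left_slope rf)[k kP] : 0 < len e' - (mu phi e)%:R * s <= len e'.
    move: sl => /andP[s0 sl].
    by rewrite subr_gt0 gerBl (len_image ee') ltr_pM2l// sl mulr_ge0// ltW.
  rewrite (slope_bwdE kP); apply/slope_fwdE/(right_slope_eq gG sl).
  apply: (right_slope_scale (F := fun s => f (edge_point e' (len e' - s)))) => //.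
  exact: (right_slope_rev (F := fun s => f (edge_point e' s))).
- have /(rational_right_slope rf)[k kP] : 0 <= len e' - (mu phi e)%:R * s < len e'.
    move: sl => /andP[s0 sl].
    by rewrite subr_ge0 gtrBl (len_image ee') ler_pM2l// sl mulr_gt0.
  rewrite (slope_fwdE kP); apply/slope_bwdE/(left_slope_eq gG sl).
  apply: (left_slope_scale (F := fun s => f (edge_point e' (len e' - s)))) => //.
  exact: (left_slope_rev (F := fun s => f (edge_point e' s))).
Qed.

(** Meant for [e'] incident to [w]: without loops such an edge leaves [w] in a single direction, so
    the [else] case is the one of a target. *)
Definition slope_from e' (w : vert Gam') : R :=
  if src e' == w then slope_fwd f e' 0 else slope_bwd f e' (len e').

Lemma sum_out_slopes_vertex w :
  sum_out_slopes f (vertex_point w) =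
  \sum_(e' : edge Gam' | incident e' w) slope_from e' w.
Proof.
rewrite /sum_out_slopes /= [RHS](bigID (fun e' => src e' == w)) /=.
congr (_ + _); apply: eq_big => [e'|e' /eqP].
- by rewrite /incident; case: eqP; rewrite ?andbF.
- by rewrite /slope_from => ->; rewrite eqxx.
- rewrite /incident; case: (src e' =P w) => [<-|_] /=; last by rewrite andbT.
  by apply/negbTE/eqP => /esym; exact: noloop.
- by move=> tw; rewrite /slope_from; case: eqP => // sw; case: (@noloop e'); rewrite sw tw.
Qed.

(** What the chain rule predicts for the outgoing slope of the composite along [e] at an end lying
    over [w]. *)
Let pulled_slope e (w : vert Gam') : R :=
  if emap phi e is inr e' then (mu phi e)%:R * slope_from e' w else 0.

Lemma slope_fwd_src e :
  slope_fwd g e 0 = pulled_slope e (vmap phi (src e)).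
Proof.
have l0 := len_gt0 e; have i0 : 0 <= (0 : R) < len e by rewrite lexx.
rewrite /pulled_slope; case ee' : (emap phi e) => [v|e'].
  exact: slope_fwd_contracted ee' _.
have j0 : 0 <= (0 : R) <= len e by rewrite lexx ltW.
rewrite /slope_from; have [H|H] := mm_edge ee'.
  have [-> // _] := slopes_preserving ee' H; rewrite mulr0.
  (* Evaluating the continuous map at the end of the edge decides which end of [e'] is the image of
     [src e]. *)
  have := H 0 j0; rewrite mulr0 !edge_point0 mm_vertex => /vertex_point_inj->.
  by rewrite eqxx.
have [-> // _] := slopes_reversing ee' H; rewrite mulr0 subr0.
have := H 0 j0; rewrite mulr0 subr0 edge_point0 edge_point_len mm_vertex.
by move=> /vertex_point_inj->; case: eqP => // /noloop.
Qed.

Lemma slope_bwd_tgt e :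
  slope_bwd g e (len e) = pulled_slope e (vmap phi (tgt e)).
Proof.
have l0 := len_gt0 e; have i0 : 0 < len e <= len e by rewrite lexx l0.
rewrite /pulled_slope; case ee' : (emap phi e) => [v|e'].
  exact: slope_bwd_contracted ee' _.
have j0 : 0 <= len e <= len e by rewrite lexx ltW.
rewrite /slope_from; have [H|H] := mm_edge ee'.
  have [_ -> //] := slopes_preserving ee' H; rewrite -(len_image ee').
  have := H _ j0; rewrite -(len_image ee') !edge_point_len mm_vertex.
  by move=> /vertex_point_inj->; case: eqP => // /noloop.
have [_ -> //] := slopes_reversing ee' H; rewrite -(len_image ee') subrr.
have := H _ j0; rewrite -(len_image ee') subrr edge_point0 edge_point_len mm_vertex.
by move=> /vertex_point_inj->; rewrite eqxx.
Qed.

Hypothesis harm : harmonic_morphism phi.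

Lemma vmult_incident (v : vert Gam) e' : incident e' (vmap phi v) ->
  vmult phi v = mult_over phi v e'.
Proof.
move=> inc; rewrite /vmult; case: pickP => [e'' inc''|/(_ e')]; last by rewrite inc.
exact: harm.
Qed.

(** At a vertex, the edges over a given [e'] contribute [mult_over] times the slope of [f] along
    [e'], and harmonicity makes this factor the same for all [e']. Inside an edge it is the chain
    rule in both directions. *)
Lemma sum_out_slopes_comp x :
  sum_out_slopes g x =
  (horizontal_mult phi x)%:R * sum_out_slopes f (mm_map phi x).
Proof.
case xE : (val x) => [v|[e s]].
  rewrite (val_inl_vertex_point xE) mm_vertex sum_out_slopes_vertex.
  rewrite /sum_out_slopes /horizontal_mult /=.
  transitivity (\sum_(e | incident e v) pulled_slope e (vmap phi v)).
    rewrite [RHS](bigID (fun e => src e == v)) /=; congr (_ + _).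
      apply: eq_big => [e|e /eqP<-]; last exact: slope_fwd_src.
      by rewrite /incident; case: (src e =P v); rewrite /= ?andbF ?andbT.
    (* A loop at [v] occurs in both sums of slopes but once among the incident edges. It is
       contracted, so its second contribution is 0. *)
    rewrite (bigID (fun e => src e == v)) /= big1 ?add0r => [|e].
      apply: eq_big => [e|e /andP[/eqP<- _]]; last exact: slope_bwd_tgt.
      by rewrite /incident; case: (src e =P v); rewrite /= ?andbF ?andbT.
    move=> /andP[/eqP tv /eqP sv]; rewrite slope_bwd_tgt /pulled_slope.
    case ee' : (emap phi e) => [//|e'].
    by case: (image_ends_neq ee'); rewrite sv tv.
  rewrite mulr_sumr.
  under [RHS]eq_bigr => e' inc do
    rewrite (vmult_incident inc) /mult_over natr_sum mulr_suml.
  rewrite (exchange_big_dep (fun e => incident e v)) /= => [|e' e _ /andP[]//].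
  apply: eq_bigr => e ev; rewrite /pulled_slope.
  case ee' : (emap phi e) => [w|e'].
    by rewrite big1// => e' /andP[_ /andP[_ /eqP]].
  rewrite (big_pred1 e')// => e'' /=; rewrite ev/= eq_sym /=.
  have [->|] := eqVneq e'' e'; last first.
    move=> ne; apply/negbTE; rewrite negb_and; apply/orP; right.
    by apply: contra_neq ne => -[].
  by rewrite eqxx andbT (image_incident ee' ev).
have xs := val_inr_inner xE; have := xs => /andP[s0 sl].
have ls : 0 <= s <= len e by rewrite !ltW.
rewrite /sum_out_slopes /horizontal_mult xE (val_inr_edge_point xE).
case ee' : (emap phi e) => [v|e'].
  have -> : mu phi e = 0%N by apply/mu_eq0; exists v.
  rewrite mul0r (slope_fwd_contracted ee') ?(slope_bwd_contracted ee') ?addr0//.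
    by rewrite s0 ltW.
  by rewrite sl ltW.
have s0l : 0 <= s < len e by rewrite sl ltW.
have sl0 : 0 < s <= len e by rewrite s0 ltW.
have [H|H] := mm_edge ee'.
  have [Ef Eb] := slopes_preserving ee' H.
  by rewrite Ef// Eb// -mulrDr H// (val_edge_point (image_inner ee' xs)).
have [Ef Eb] := slopes_reversing ee' H.
rewrite Ef// Eb// -mulrDr H// addrC val_edge_point//.
have := image_inner ee' xs; lra.
Qed.

End Function.

Lemma pullback_lin_equiv D D' : harmonic_morphism phi ->
  lin_equiv D D' -> lin_equiv (pullback phi D) (pullback phi D').
Proof.
move=> harm [f rf fD]; exists (fun x => f (mm_map phi x)).
  exact: rational_comp.
move=> x; rewrite sum_out_slopes_comp// -fD coeffB !coeff_pullback -mulrBr.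
by rewrite intrM coeffB.
Qed.

End Pullback.

(** * Bridges and functions supported on one edge *)

Section Bridges.
Variable G : multigraph.
Implicit Types (x y : vert G) (e : edge G) (p : seq (vert G)).

Definition adjacent_without e x y : bool :=
  [exists e' : edge G, (e' != e) &&
    (((src e' == x) && (tgt e' == y)) || ((src e' == y) && (tgt e' == x)))].

(** Chooses an edge for each step of a simple path. The last clause lets the resulting walk be
    appended to any dart arriving at [x]. *)
Lemma path_darts e x p : path (adjacent_without e) x p -> uniq (x :: p) ->
  exists c : seq (dart G),
  [/\ [seq dart_tail a | a <- c] = belast x p,
      [seq dart_head a | a <- c] = p,
      e \notin [seq a.1 | a <- c],
      uniq [seq a.1 | a <- c] &
      forall a : dart G, dart_head a = x ->
        path (fun a b : dart G => dart_head a == dart_tail b) a c].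
Proof.
elim: p x => [|y p IH] x; first by exists [::].
rewrite [path _ _ _]/= => /andP[/existsP[e1 /andP[e1e e1xy]] yp].
rewrite cons_uniq => /andP[xyp uyp]; have [c [tl hd ec uc pc]] := IH y yp uyp.
pose b : dart G := (e1, (src e1 == x) && (tgt e1 == y)).
have [bt bh] : dart_tail b = x /\ dart_head b = y.
  rewrite /dart_tail /dart_head /=.
  by case: ifP e1xy => [/andP[/eqP-> /eqP->] //|_ /= /andP[/eqP-> /eqP->]].
exists (b :: c); split=> /=.
- by rewrite bt tl.
- by rewrite bh hd.
- by rewrite inE negb_or eq_sym e1e.
(* If [e1] were used again, [x] would be an end of a later dart, against the simplicity of the
   path. *)
- rewrite uc andbT; apply/mapP => -[a ac e1a].
  have ta : dart_tail a \in y :: p by rewrite mem_belast// -tl map_f.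
  have ha : dart_head a \in y :: p by rewrite inE -hd map_f ?orbT.
  have : x = dart_tail a \/ x = dart_head a.
    move: e1xy; rewrite e1a /dart_tail /dart_head.
    by case: a.2 => /orP[] /andP[/eqP-> /eqP->]; [left|right|right|left].
  by case=> xE; move: xyp; rewrite xE ?ta ?ha.
- by move=> a ax; rewrite ax bt eqxx pc.
Qed.

(** A simple path from the target back to the source avoiding [e] would close up with [e] to a
    cycle; the empty path accounts for loops. *)
Lemma tree_bridge e : is_tree G ->
  ~~ connect (adjacent_without e) (tgt e) (src e).
Proof.
move=> [_ acyclic]; apply/connectP => -[p0 /shortenP[p pp up _] lastp].
have [c [tl hd ec uc pc]] := path_darts pp up.
have /negP[] := acyclic ((e, true) :: c).
apply/and4P; split=> //=.
- rewrite rcons_path pc//=; apply/eqP.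
  by rewrite -last_map hd.
- by move: up; rewrite lastI rcons_uniq tl -lastp.
- by rewrite ec uc.
Qed.

Lemma tree_no_loop e : is_tree G -> src e <> tgt e.
Proof. by move=> /(tree_bridge e) + se; rewrite se connect0. Qed.

Definition beyond e : pred (vert G) := connect (adjacent_without e) (tgt e).

(** An edge other than [e] survives the cut, so it lies on one side; a function constant on each
    side is thus constant along it. *)
Lemma beyond_other_edge e e' : e' != e -> beyond e (src e') = beyond e (tgt e').
Proof.
move=> e'e; apply/idP/idP => /connect_trans; apply; apply: connect1;
by apply/existsP; exists e'; rewrite e'e !eqxx ?orbT.
Qed.

End Bridges.

Section EdgeFunctions.
Variables (R : realType) (Gam : metric_graph R).
Variables (f : graph_point Gam -> R) (e0 : edge Gam) (F : R -> R).
Hypothesis f_other : forall e, e != e0 -> exists c,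
  forall s, 0 <= s <= len e -> f (edge_point e s) = c.
Hypothesis f_edge : forall s, 0 <= s <= len e0 -> f (edge_point e0 s) = F s.

Lemma rational_edge_function ts :
  breakpoints F (len e0) ts -> rational_function f.
Proof.
move=> bF; apply/rational_functionP; exists (fun e => ts) => e.
have [->|ne] := eqVneq e e0; first exact: breakpoints_eq f_edge bF.
have [c fc] := f_other ne; apply: breakpoints_eq fc _ => a b _ _ _ _.
by exists 0; exact: linear_on_cst.
Qed.

Lemma slope_fwd_other e s : e != e0 -> 0 <= s < len e -> slope_fwd f e s = 0.
Proof.
move=> /f_other[c fc] sl; apply/slope_fwdE/(right_slope_eq fc sl).
by exists (s + 1); [rewrite ltrDl|exact: linear_on_cst].
Qed.

Lemma slope_bwd_other e s : e != e0 -> 0 < s <= len e -> slope_bwd f e s = 0.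
Proof.
move=> /f_other[c fc] sl; apply/slope_bwdE/(left_slope_eq fc sl).
by exists (s - 1); [rewrite gtrBl|rewrite oppr0; exact: linear_on_cst].
Qed.

Variables r l : R -> R.
Hypothesis rF : forall s, 0 <= s < len e0 -> right_slope F s (r s).
Hypothesis lF : forall s, 0 < s <= len e0 -> left_slope F s (l s).

Lemma sum_out_slopes_edge_function x : sum_out_slopes f x =
  match val x with
  | inl v => (src e0 == v)%:R * r 0 + (tgt e0 == v)%:R * l (len e0)
  | inr (e, s) => (e == e0)%:R * (r s + l s)
  end.
Proof.
have L0 := len_gt0 e0.
rewrite /sum_out_slopes; case xE : (val x) => [v|[e s]].
  congr (_ + _).
    rewrite big_mkcond (bigD1 e0)//= big1 ?addr0 => [|e ne].
      case: eqP => _; last by rewrite mul0r.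
      rewrite mul1r; apply/slope_fwdE/(right_slope_eq f_edge); first by rewrite lexx.
      by apply: rF; rewrite lexx.
    by case: ifP => // _; apply: slope_fwd_other; rewrite ?lexx ?len_gt0.
  rewrite big_mkcond (bigD1 e0)//= big1 ?addr0 => [|e ne].
    case: eqP => _; last by rewrite mul0r.
    rewrite mul1r; apply/slope_bwdE/(left_slope_eq f_edge); first by rewrite lexx L0.
    by apply: lF; rewrite lexx L0.
  by case: ifP => // _; apply: slope_bwd_other; rewrite ?lexx ?len_gt0.
have /andP[s0 sl] := val_inr_inner xE.
have s1 : 0 <= s < len e by rewrite sl ltW.
have s2 : 0 < s <= len e by rewrite s0 ltW.
have [ee0|ne] := eqVneq e e0; last first.
  by rewrite slope_fwd_other// slope_bwd_other// addr0 mul0r.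
rewrite {e xE sl}ee0 in s1 s2 *; rewrite mul1r; congr (_ + _).
  exact/slope_fwdE/(right_slope_eq f_edge s1)/rF.
exact/slope_bwdE/(left_slope_eq f_edge s2)/lF.
Qed.

End EdgeFunctions.

(** * Ramps and tents on an interval *)

Section Ramps.
Variable R : realType.
Implicit Types (c s L : R).

Lemma breakpoints_min c L : breakpoints (fun s => Num.min s c) L [:: c].
Proof.
move=> a b _ ab _ /(_ c); rewrite mem_seq1 eqxx negb_and -!leNgt => /(_ isT).
move=> /orP[ca|bc]; [exists 0|exists 1] => s /andP[as_ sb].
  by rewrite !min_r ?(le_trans ca)// mul0r addr0.
by rewrite !min_l ?(le_trans _ bc) ?(ltW ab)// mul1r addrC subrK.
Qed.

Lemma right_slope_min c s : right_slope (fun s => Num.min s c) s (s < c)%R%:R.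
Proof.
have [sc|cs] := ltP s c.
  exists c => // x /andP[sx xc].
  by rewrite !min_l// ?(ltW sc)// mul1r addrC subrK.
exists (s + 1) => [|x /andP[sx _]]; first by rewrite ltrDl.
by rewrite !min_r// ?(le_trans cs)// mul0r addr0.
Qed.

Lemma left_slope_min c s : left_slope (fun s => Num.min s c) s (- (s <= c)%R%:R).
Proof.
have [sc|cs] := leP s c.
  exists (s - 1) => [|x /andP[_ xs]]; first by rewrite gtrBl.
  have s1 : s - 1 <= c by lra.
  by rewrite !min_l// ?(le_trans xs)// opprK mul1r addrC subrK.
exists c => // x /andP[cx _].
by rewrite !min_r// oppr0 oppr0 mul0r addr0.
Qed.

(** For [c] and [s] in [0, L] this is the trapezoid of slopes 1, 0, -1 and height the minimum of [c]
    and [L - c]. It is written with differences so that [breakpointsB] and the slope lemmas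
    apply. *)
Definition tent L c s : R := Num.min s c - (c - Num.min (L - s) c).

Lemma breakpoints_tent L c : exists ts, breakpoints (tent L c) L ts.
Proof.
have bc : breakpoints (fun=> c) L [::].
  by move=> a b _ _ _ _; exists 0; exact: linear_on_cst.
have bm := @breakpoints_min c L.
by eexists; exact: breakpointsB bm (breakpointsB bc (breakpoints_rev bm)).
Qed.

Lemma right_slope_tent L c s :
  right_slope (tent L c) s ((s < c)%R%:R - (L - s <= c)%R%:R).
Proof.
have rc : right_slope (fun=> c) s 0.
  by exists (s + 1); [rewrite ltrDl|exact: linear_on_cst].
have := right_slopeB (right_slope_min c s)
  (right_slopeB rc (right_slope_rev (left_slope_min c (L - s)))).
by rewrite sub0r opprK.
Qed.

Lemma left_slope_tent L c s :
  left_slope (tent L c) s ((L - s < c)%R%:R - (s <= c)%R%:R).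
Proof.
have lc : left_slope (fun=> c) s 0.
  by exists (s - 1); [rewrite gtrBl|rewrite oppr0; exact: linear_on_cst].
have := left_slopeB (left_slope_min c s)
  (left_slopeB lc (left_slope_rev (right_slope_min c (L - s)))).
by rewrite sub0r opprK addrC.
Qed.

(** The two indicators come from the right and left slopes of a ramp; they differ only at its
    corner, where the divisor is -1. *)
Lemma lt_sub_le (s c : R) : (s < c)%R%:R - (s <= c)%R%:R = - (s == c)%:R :> R.
Proof. by case: ltgtP => _; rewrite ?subrr ?oppr0 ?sub0r ?subr0. Qed.

End Ramps.

(** * Linear equivalences obtained from ramps and tents *)

Section Equivalences.
Variables (R : realType) (Gam : metric_graph R).

Lemma coeff_point (x y : graph_point Gam) : coeff x << y >> = (y == x)%:Z.
Proof. by rewrite coeffU mul1r; case: eqP. Qed.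

(** Allowing [c = len e], where the first point is a vertex and both sides are false, lets
    [lin_equiv_src] reach the target of the edge too. *)
Lemma edge_point_eq_inner (e e' : edge Gam) (c s : R) :
  0 < c <= len e -> 0 < s < len e' ->
  (edge_point e c == edge_point e' s) = (e' == e) && (s == c).
Proof.
move=> /andP[c0]; rewrite le_eqVlt => /predU1P[->|cl] sl.
  rewrite edge_point_len -val_eqE (val_edge_point sl) /=.
  apply/esym/negP => /andP[/eqP ee /eqP se].
  by move: sl; rewrite se ee ltxx andbF.
by rewrite -val_eqE (val_edge_point sl) val_edge_point ?c0// eq_sym.
Qed.

(* The chips move from the two ends of the edge towards each other at equal
   speed. *)
Lemma lin_equiv_tent (e : edge Gam) (c : R) : 0 < c < len e ->
  lin_equiv (<< vertex_point (src e) >> + << vertex_point (tgt e) >>)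
            (<< edge_point e c >> + << edge_point e (len e - c) >>).
Proof.
move=> /andP[c0 cL]; have L0 := len_gt0 e.
pose f (x : graph_point Gam) : R :=
  if val x is inr (e', s) then if e' == e then tent (len e) c s else 0 else 0.
have tent0 : tent (len e) c 0 = 0.
  by rewrite /tent subr0 min_l ?min_r ?ltW// subrr subrr.
have tentL : tent (len e) c (len e) = 0.
  by rewrite /tent subrr min_r 1?min_l ?ltW// subr0 subrr.
have f_ends e' : f (edge_point e' 0) = 0 /\ f (edge_point e' (len e')) = 0.
  by rewrite edge_point0 edge_point_len.
have f_other e' : e' != e -> exists c0,
    forall s, 0 <= s <= len e' -> f (edge_point e' s) = c0.
  move=> ne; exists 0 => s /andP[].
  rewrite le_eqVlt => /predU1P[<- _|s0]; first by have [] := f_ends e'.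
  rewrite le_eqVlt => /predU1P[->|sl]; first by have [] := f_ends e'.
  by rewrite /f val_edge_point ?s0// (negPf ne).
have f_edge s : 0 <= s <= len e -> f (edge_point e s) = tent (len e) c s.
  move=> /andP[].
  rewrite le_eqVlt => /predU1P[<- _|s0]; first by have [-> _] := f_ends e.
  rewrite le_eqVlt => /predU1P[->|sl]; first by have [_ ->] := f_ends e.
  by rewrite /f val_edge_point ?s0// eqxx.
have [ts bts] := breakpoints_tent (len e) c.
exists f; first exact (rational_edge_function f_other f_edge bts).
move=> x; rewrite (sum_out_slopes_edge_function f_other f_edge
  (fun s _ => right_slope_tent (len e) c s)
  (fun s _ => left_slope_tent (len e) c s)).
have cL' : 0 < len e - c < len e by rewrite subr_gt0 cL gtrBl.
rewrite coeffB !coeffD !coeff_point rmorphB !rmorphD/=.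
case xE : (val x) => [v|[e' s]].
  rewrite (val_inl_vertex_point xE) !(inj_eq (@vertex_point_inj _ _)).
  rewrite -!val_eqE !val_edge_point ?c0//= subr0 subrr c0 leNgt cL.
  by rewrite /= !mulr0z addr0 !subr0 !mulr1 -!pmulrn.
have sl := val_inr_inner xE.
rewrite (val_inr_edge_point xE) !edge_point_eq_inner ?c0 ?(ltW cL)//; last first.
  by have /andP[-> /ltW->] := cL'.
rewrite -!val_eqE !(val_edge_point sl) /=.
have [_|_] := eqVneq e' e; last by rewrite mul0r !add0r oppr0.
rewrite mul1r /= [RHS]addrACA [X in _ = X + _]addrC.
(* One chip for the corner of each ramp; the corners coincide when [c] is half the length. *)
have := lt_sub_le s c; have := lt_sub_le (len e - s) c.
have -> : (len e - s == c) = (s == len e - c).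
  by rewrite subr_eq addrC -subr_eq eq_sym.
rewrite !pmulrn; lra.
Qed.

Hypothesis tree : is_tree Gam.

Lemma lin_equiv_src (e : edge Gam) (c : R) : 0 < c <= len e ->
  lin_equiv << vertex_point (src e) >> << edge_point e c >>.
Proof.
move=> /andP[c0 cL]; have L0 := len_gt0 e.
(* The value is 0 on the source side of the bridge and [c] beyond it, with a ramp along [e]. The
   values match at the target because [c <= len e], and at the source because [src e] is not beyond
   [e]. *)
pose f (x : graph_point Gam) : R :=
  match val x with
  | inl v => if beyond e v then c else 0
  | inr (e', s) => if e' == e then Num.min s c
                   else if beyond e (src e') then c else 0
  end.
have src0 : f (vertex_point (src e)) = 0.
  by rewrite /f /= /beyond (negPf (tree_bridge e tree)).
have tgtc : f (vertex_point (tgt e)) = c by rewrite /f /= /beyond connect0.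
have f_other e' : e' != e -> exists c0,
    forall s, 0 <= s <= len e' -> f (edge_point e' s) = c0.
  move=> ne; exists (if beyond e (src e') then c else 0) => s /andP[].
  rewrite le_eqVlt => /predU1P[<- _|s0]; first by rewrite edge_point0.
  rewrite le_eqVlt => /predU1P[->|sl].
    by rewrite edge_point_len (beyond_other_edge ne).
  by rewrite /f val_edge_point ?s0// (negPf ne).
have f_edge s : 0 <= s <= len e -> f (edge_point e s) = Num.min s c.
  move=> /andP[].
  rewrite le_eqVlt => /predU1P[<- _|s0]; first by rewrite edge_point0 src0 min_l ?ltW.
  rewrite le_eqVlt => /predU1P[->|sl]; first by rewrite edge_point_len tgtc min_r.
  by rewrite /f val_edge_point ?s0// eqxx.
exists f.
  exact (rational_edge_function f_other f_edge (@breakpoints_min _ c _)).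
move=> x; rewrite (sum_out_slopes_edge_function f_other f_edge
  (fun s _ => right_slope_min c s) (fun s _ => left_slope_min c s)).
rewrite coeffB !coeff_point rmorphB/=.
case xE : (val x) => [v|[e' s]].
  rewrite (val_inl_vertex_point xE) (inj_eq (@vertex_point_inj _ _)) c0 mulr1.
  rewrite mulrN -natrM mulnb; congr (_ - _%:R).
  move: cL; rewrite le_eqVlt => /predU1P[->|cl].
    by rewrite edge_point_len lexx andbT (inj_eq (@vertex_point_inj _ _)).
  by rewrite leNgt cl andbF -val_eqE val_edge_point ?c0.
have sl := val_inr_inner xE.
rewrite (val_inr_edge_point xE) edge_point_eq_inner ?c0//.
rewrite -val_eqE (val_edge_point sl) /= lt_sub_le.
by case: (e' == e); rewrite ?mul1r ?mul0r sub0r -?pmulrn ?oppr0.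
Qed.

Lemma lin_equiv_vertices (u v : vert Gam) :
  lin_equiv << vertex_point u >> << vertex_point v >>.
Proof.
have [[_ conn] _] := tree.
have /connectP[p] := conn u v; elim: p u => [|w p IH] u /=.
  by move=> _ ->; exact: lin_equiv_refl.
move=> /andP[/existsP[e uw] wp] vE; apply: lin_equiv_trans (IH w wp vE).
(* Ramping up along the whole edge moves the chip from one end to the other. *)
have st : lin_equiv << vertex_point (src e) >> << vertex_point (tgt e) >>.
  by rewrite -edge_point_len; apply: lin_equiv_src; rewrite len_gt0 lexx.
by move: uw => /orP[]/andP[/eqP<- /eqP<-] //; exact: lin_equiv_sym.
Qed.

Lemma lin_equiv_points (x y : graph_point Gam) : lin_equiv << x >> << y >>.
Proof.
suff H (z : graph_point Gam) : exists v, lin_equiv << vertex_point v >> << z >>.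
  have [v xv] := H x; have [w yw] := H y.
  apply: lin_equiv_trans (lin_equiv_sym xv) _.
  exact: lin_equiv_trans (lin_equiv_vertices v w) yw.
case zE : (val z) => [v|[e s]].
  by exists v; rewrite (val_inl_vertex_point zE); exact: lin_equiv_refl.
exists (src e); rewrite (val_inr_edge_point zE); apply: lin_equiv_src.
by have /andP[-> /ltW->] := val_inr_inner zE.
Qed.

End Equivalences.

(** * Pullbacks of points *)

Section PointPullback.
Variables (R : realType) (Gam Gam' : metric_graph R).
Variable phi : metric_morphism Gam Gam'.

Lemma coeff_pullback_point (t : graph_point Gam') (z : graph_point Gam) :
  coeff z (pullback phi << t >>) =
  (horizontal_mult phi z * (t == mm_map phi z))%N%:Z.
Proof. by rewrite coeff_pullback coeff_point PoszM. Qed.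

Lemma effective_pullback_point (t : graph_point Gam') :
  effective (pullback phi << t >>).
Proof. by move=> z; rewrite coeff_pullback_point. Qed.

(** The midpoint is fixed by reversal, so its image does not depend on the direction in which [e] is
    mapped. *)
Lemma mm_map_midpoint (e : edge Gam) (e' : edge Gam') : emap phi e = inr e' ->
  mm_map phi (edge_point e (len e / 2)) = edge_point e' (len e' / 2).
Proof.
move=> ee'; have L0 := len_gt0 e.
have mE : (mu phi e)%:R * (len e / 2) = len e' / 2 :> R.
  by rewrite mulrA -(len_image ee').
have i : 0 <= len e / 2 <= len e by apply/andP; split; lra.
have [->//|->//] := mm_edge ee'; rewrite mE//; congr edge_point; lra.
Qed.

(** The fiber consists of the midpoints of the edges over [e'], each with multiplicity [mu]; their
    sum is the degree of the morphism. *)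
Lemma deg_pullback_midpoint d (e' : edge Gam') : morphism_has_degree phi d ->
  deg (pullback phi << edge_point e' (len e' / 2) >>) = d%:Z.
Proof.
move=> degphi; set t := edge_point e' _.
have L0 := len_gt0 e'.
have tE : val t = inr (e', len e' / 2).
  by rewrite val_edge_point//; apply/andP; split; lra.
pose us (e : edge Gam) : seq R :=
  if emap phi e == inr e' then [:: len e / 2] else [::].
rewrite (@deg_vertex_edge _ _ us).
- rewrite big1 ?add0r => [|v _]; last first.
    by rewrite coeff_pullback_point mm_vertex -val_eqE tE muln0.
  rewrite -(degphi e') (big_morph Posz PoszD (erefl 0%:Z)) [RHS]big_mkcond /=.
  apply: eq_bigr => e _; rewrite /us; case: eqP => [ee'|_]; last by rewrite big_nil.
  rewrite big_seq1 coeff_pullback_point (mm_map_midpoint ee') eqxx muln1.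
  rewrite /horizontal_mult val_edge_point//.
  by have := len_gt0 e; move=> l0; apply/andP; split; lra.
- by move=> e; rewrite /us; case: ifP.
- move=> e s; rewrite /us; case: ifP => // _; rewrite mem_seq1 => /eqP->.
  by have := len_gt0 e; move=> l0; apply/andP; split; lra.
(* A point of the support lies on an edge that is not contracted, and in either direction its
   parameter is forced to be half the length. *)
- move=> x e s; rewrite mem_dom coeff_pullback_point => c0 xE.
  have /eqP tx : t == mm_map phi x.
    by apply: contraNT c0 => /negPf->; rewrite muln0.
  have mu0 : mu phi e != 0%N.
    by apply: contraNneq c0 => m0; rewrite /horizontal_mult xE m0 mul0n.
  case ee' : (emap phi e) => [v|e1].
    by case/eqP: mu0; apply/mu_eq0; exists v.
  have m0 : (mu phi e)%:R != 0 :> R by rewrite pnatr_eq0.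
  have lE := len_image ee'.
  suff [e1E sE] : e1 = e' /\ (mu phi e)%:R * s = len e1 / 2.
    rewrite /us ee' e1E eqxx mem_seq1; apply/eqP/(mulfI m0).
    by rewrite sE lE mulrA.
  have := mm_map_inner xE ee'; rewrite -tx tE => -[] [<- ms]; split=> //; lra.
Qed.

End PointPullback.

(** * Removing a point from its own fiber *)

Section RankAtLeastOne.
Variables (R : realType) (Gam GamT : metric_graph R).
Variable phi : metric_morphism Gam GamT.
Hypothesis nondeg : nondegenerate_morphism phi.

Lemma fiber_minus_point (x : graph_point Gam) :
  equiv_effective (pullback phi << mm_map phi x >> - << x >>).
Proof.
set P := pullback _ _; have [nocontr vmult1] := nondeg.
have P0 : effective P by exact: effective_pullback_point.
have [hx|] := posnP (horizontal_mult phi x); last first.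
  move=> hx; exists (P - << x >>); last exact: lin_equiv_refl.
  move=> z; rewrite coeffB coeff_point subr_ge0.
  have [<-|_] := eqVneq x z; last exact: P0.
  by rewrite coeff_pullback_point eqxx muln1 lez_nat.
case xE : (val x) => [v|[e s]].
  by have := vmult1 v; rewrite -[vmult phi v]/(horizontal_mult phi (vertex_point v))
    -(val_inl_vertex_point xE) hx.
have sl := val_inr_inner xE; have /andP[s0 sL] := sl.
have [v ev] : exists v, emap phi e = inl v.
  by apply/mu_eq0; move: hx; rewrite /horizontal_mult xE.
have [sv tv] := emap_contracted ev.
have xv : mm_map phi x = vertex_point v.
  by rewrite (val_inr_edge_point xE) (mm_contracted ev)// !ltW.
pose u := vertex_point (src e); pose w := vertex_point (tgt e).
pose x' := edge_point e (len e - s).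
(* No loop is contracted, so the two ends are distinct and [P] has a chip on each. *)
have uw : u != w.
  apply/eqP => /vertex_point_inj st; exact: (nocontr e st v).
have Pu : 1 <= coeff u P.
  rewrite coeff_pullback_point mm_vertex sv xv eqxx muln1 lez_nat.
  exact: vmult1.
have Pw : 1 <= coeff w P.
  rewrite coeff_pullback_point mm_vertex tv xv eqxx muln1 lez_nat.
  exact: vmult1.
(* The chips at [u] and [w] are traded for chips at [x] and its mirror point [x'], and the chip at
   [x] pays for the subtraction. *)
exists (P + << x' >> - (<< u >> + << w >>)).
  move=> z; rewrite coeffB !coeffD !coeff_point.
  have Pz := P0 z.
  have [uz|_] := eqVneq u z.
    rewrite -uz [w == u]eq_sym (negPf uw) addr0 subr_ge0.
    by rewrite (le_trans Pu)// lerDl.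
  have [wz|_] := eqVneq w z; last by rewrite subr_ge0; apply: addr_ge0.
  by rewrite -wz add0r subr_ge0 (le_trans Pw)// lerDl.
have := lin_equiv_sub (lin_equiv_refl (P + << x' >>))
  (lin_equiv_sym (lin_equiv_tent sl)).
by rewrite -(val_inr_edge_point xE) opprD addrACA subrr addr0.
Qed.

End RankAtLeastOne.

Theorem lemma2p10 (R : realType) (Gam GamT : metric_graph R)
    (phi : metric_morphism Gam GamT) (d : nat) :
  (1 <= d)%N ->
  is_tree GamT ->
  harmonic_morphism phi ->
  nondegenerate_morphism phi ->
  morphism_has_degree phi d ->
  forall t : graph_point GamT,
    let D := pullback phi << t >> in
    [/\ deg D = d%:Z, 1 <= divisor_rank D & W 1 d%:Z (lin_class D)].
Proof.
move=> _ tree harm nondeg degphi t D.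
have fibers (y : graph_point GamT) : lin_equiv D (pullback phi << y >>).
  apply: pullback_lin_equiv => [e'||]; first exact: tree_no_loop.
  - exact: harm.
  - exact: lin_equiv_points.
have [/card_gt0P[v _] _] := model_connected Gam.
(* A multiplicity of at least 1 excludes the default 0 of [vmult], so the tree has an edge. *)
have [e' _] : exists e' : edge GamT, incident e' (vmap phi v).
  have := nondeg.2 v; rewrite /vmult; case: pickP => // e' inc _.
  by exists e'.
have degD : deg D = d%:Z.
  by rewrite (lin_equiv_deg (fibers (edge_point e' (len e' / 2))))
    (deg_pullback_midpoint e' degphi).
have rankD : 1 <= divisor_rank D.
  apply: (@le_divisor_rank _ _ _ 1); first by constructor; exact: vertex_point v.
    by exists D; [exact: effective_pullback_point|exact: lin_equiv_refl].
  (* An effective divisor of degree 1 is a single point [x]; [D] is then replaced by the fiber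
     through [x]. *)
  move=> E eE degE; have [x ->] := deg1pos (introT (fgposP E) eE) degE.
  have [D' eD' D'E] := fiber_minus_point nondeg x; exists D' => //.
  exact: lin_equiv_trans (lin_equiv_sub (fibers _) (lin_equiv_refl _)) D'E.
by split=> //; exists D.
Qed.
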